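(* Assume (A0)–(A3) as in the context. (i) If $-1<r\le1$ and (M$_p$) holds with some $p>2$, then for any $\varepsilon>0$, a.s., for all but finitely many $t$, $$t^{1/2}(\log t)^{-\frac{4+r}{1+r}-\varepsilon}\le\max_{1\le s\le t}X_s\le t^{1/2}(\log t)^{\frac{3}{1+r}+\varepsilon}.$$ (ii) If $r>1$ and (M$_p$) holds with some $p>1+r$, then for any $\varepsilon>0$, a.s., for all but finitely many $t$, $$t^{\frac{1}{1+r}}(\log t)^{-\frac{1}{1+r}-\varepsilon}\le\max_{1\le s\le t}X_s\le t^{\frac{1}{1+r}}(\log t)^{\frac{2}{1+r}+\varepsilon}.$$
   Context: $\mathbb{N}=\{1,2,\dots\}$. (A0): $\mathbb{S}$ is a locally finite (every bounded set meets it in finitely many points), unbounded subset of $[0,\infty)$ with $0\in\mathbb{S}$; $(X_t)_{t\in\mathbb{N}}$ is an $\mathbb{S}$-valued process adapted to a filtration $(\mathcal{F}_t)_{t\in\mathbb{N}}$ with $\mathbb{P}[X_1=0]=1$. (A1): for each $x,y\in\mathbb{S}$ there exist $m(x,y)\in\mathbb{N}$, $\varphi(x,y)>0$ with $\mathbb{P}[X_{t+m(X_t,y)}=y\mid\mathcal{F}_t]\ge\varphi(X_t,y)$ a.s. for all $t$. Write $\Delta_t:=X_{t+1}-X_t$. (A2): there are $c\in\mathbb{R}$, $s^2\in(0,\infty)$ with, as $X_t\to\infty$, $\mathbb{E}[\Delta_t\mid\mathcal{F}_t]=cX_t^{-1}+o(X_t^{-1}(\log X_t)^{-1})$ and $\mathbb{E}[\Delta_t^2\mid\mathcal{F}_t]=s^2+o((\log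 X_t)^{-1})$ a.s., where the implicit constants in $o(\cdot)$ are non-random and uniform in $t$ and in the sample point. Set $r:=-2c/s^2$. Excursions: $\tau_0:=1$, $\tau_n:=\min\{t>\tau_{n-1}:X_t=0\}$ ($\min\emptyset=\infty$), $\eta_n:=\tau_n-\tau_{n-1}$, $\mathcal{E}_n:=(X_t)_{\tau_{n-1}\le t\le\tau_n-1}$, $N:=\min\{n\in\mathbb{N}:\tau_n=\infty\}$. (A3): (a) on $\{N=\infty\}$, $(\mathcal{E}_n)_{n\in\mathbb{N}}$ is i.i.d.; (b) $\mathbb{P}[\eta_{n+1}<\infty\mid\tau_n<\infty]=\mathbb{P}[\eta_1<\infty]$ for all $n$. (M$_p$): there exist $\delta>0$, $C<\infty$ with $\mathbb{E}[|\Delta_t|^p\mid\mathcal{F}_t]\le C(1+X_t)^{p-2-\delta}$ a.s. for all $t$. *)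

(* Defs.v *)
From HB Require Import structures.
From mathcomp Require Import all_boot all_order all_algebra.
From mathcomp Require Import all_classical all_reals all_analysis.
From mathcomp Require Import measurable_realfun.
Set Implicit Arguments. Unset Strict Implicit. Unset Printing Implicit Defensive.
Import Order.TTheory GRing.Theory Num.Theory.
Local Open Scope classical_set_scope.
Local Open Scope ring_scope.

Definition G_meas d (T : measurableType d) d' (U : measurableType d')
  (G : set (set T)) (f : T -> U) : Prop :=
  forall B, measurable B -> G (f @^-1` B).

Definition is_filtration d (T : measurableType d) (F : nat -> set (set T)) :=
  forall t, (0 < t)%N ->
    [/\ @sigma_algebra T setT (F t), F t `<=` measurable & F t `<=` F t.+1].

Definition adapted d (T : measurableType d) (R : realType)
  (F : nat -> set (set T)) (X : nat -> T -> R) :=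
  forall t, (0 < t)%N -> G_meas (F t) (X t).

(* Z is a version of the (generalized, [0,+oo]-valued) conditional
   expectation E[Y | G] of a nonnegative extended-real random variable Y. *)
Definition is_cexp d (T : measurableType d) (R : realType)
  (P : probability T R) (G : set (set T)) (Y Z : T -> \bar R) : Prop :=
  [/\ G_meas G Z, (forall w, 0 <= Z w)%E &
      forall A, G A -> (\int[P]_(w in A) Y w = \int[P]_(w in A) Z w)%E].

(* Return times to 0: tau 0 = 1, tau n = min {t > tau (n-1) : x t = 0};
   None stands for +oo. *)
Fixpoint tau (R : realType) (n : nat) (x : nat -> R) : option nat :=
  match n with
  | 0 => Some 1%N
  | n'.+1 =>
    match tau n' x with
    | None => None
    | Some s =>
      match pselect (exists t, (s < t)%N && (x t == 0)) with
      | left H => Some (@ex_minn (fun t => (s < t)%N && (x t == 0)) H)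
      | right _ => None
      end
    end
  end.

(* n-th excursion E_n = (x_t)_{tau_{n-1} <= t <= tau_n - 1} (n >= 1);
   only meaningful when tau_n < oo. *)
Definition exc (R : realType) (n : nat) (x : nat -> R) : seq R :=
  match tau n.-1 x, tau n x with
  | Some a, Some b => [seq x s | s <- iota a (b - a)]
  | _, _ => [::]
  end.

Definition Ninf (R : realType) (x : nat -> R) : Prop :=
  forall n, tau n x <> None.

Definition path_of d (T : measurableType d) (R : realType)
  (X : nat -> T -> R) (w : T) : nat -> R := fun s => X s w.

Definition runmax d (T : measurableType d) (R : realType)
  (X : nat -> T -> R) (t : nat) (w : T) : R :=
  \big[Num.max/0]_(1 <= s < t.+1) X s w.

Definition A0 d (T : measurableType d) (R : realType) (P : probability T R)
  (F : nat -> set (set T)) (X : nat -> T -> R) (S : set R) : Prop :=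
  [/\ S 0, (forall x, S x -> 0 <= x),
      (forall b : R, finite_set [set x | S x /\ x <= b]) &
      (forall b : R, exists x, S x /\ b < x)] /\
  [/\ is_filtration F, adapted F X,
      (forall t w, (0 < t)%N -> S (X t w)) &
      P [set w | X 1%N w = 0] = 1%E].

Definition A1 d (T : measurableType d) (R : realType) (P : probability T R)
  (F : nat -> set (set T)) (X : nat -> T -> R) (S : set R) : Prop :=
  exists (m : R -> R -> nat) (phi : R -> R -> R),
    (forall x y, S x -> S y -> (0 < m x y)%N /\ 0 < phi x y) /\
    forall y, S y -> forall t, (0 < t)%N ->
      exists Z : T -> \bar R,
        is_cexp P (F t) (fun w => ((X (t + m (X t w) y)%N w == y)%:R)%:E) Z /\
        {ae P, forall w, ((phi (X t w) y)%:E <= Z w)%E}.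

(* (A2), with constants c and s2; the o(.) terms are uniform:
   for every eps > 0 there is x0 such that for all t, a.s. on {X_t >= x0},
   the bounds hold.  E[Delta_t | F_t] := E[Delta_t^+ | F_t] - E[Delta_t^- | F_t]. *)
Definition A2 d (T : measurableType d) (R : realType) (P : probability T R)
  (F : nat -> set (set T)) (X : nat -> T -> R) (c s2 : R) : Prop :=
  0 < s2 /\
  exists Zp Zn Z2 : nat -> T -> \bar R,
    (forall t, (0 < t)%N ->
      [/\ is_cexp P (F t) (fun w => (Num.max (X t.+1 w - X t w) 0)%:E) (Zp t),
          is_cexp P (F t) (fun w => (Num.max (X t w - X t.+1 w) 0)%:E) (Zn t) &
          is_cexp P (F t) (fun w => ((X t.+1 w - X t w) ^+ 2)%:E) (Z2 t)]) /\
    forall eps : R, 0 < eps -> exists x0 : R, forall t, (0 < t)%N ->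
      {ae P, forall w, x0 <= X t w ->
        [/\ Zp t w \is a fin_num, Zn t w \is a fin_num, Z2 t w \is a fin_num,
            `|fine (Zp t w) - fine (Zn t w) - c / X t w|
               <= eps / (X t w * ln (X t w)) &
            `|fine (Z2 t w) - s2| <= eps / ln (X t w)]}.

Definition A3 d (T : measurableType d) (R : realType) (P : probability T R)
  (X : nat -> T -> R) : Prop :=
  (* (a) on {N = oo}, (E_n)_{n>=1} i.i.d.: product rule under P( . | N = oo),
     written multiplied out (vacuous if P(N = oo) = 0) *)
  (forall (k : nat) (A : nat -> set (seq R)),
     fine (P [set w | Ninf (path_of X w) /\
                      forall i, (i <= k)%N -> A i (exc i.+1 (path_of X w))])
       * fine (P [set w | Ninf (path_of X w)]) ^+ k
     = \prod_(i < k.+1)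
         fine (P [set w | Ninf (path_of X w) /\ A i (exc 1 (path_of X w))])) /\
  (* (b) P[eta_{n+1} < oo | tau_n < oo] = P[eta_1 < oo], multiplied out *)
  (forall n, (0 < n)%N ->
     fine (P [set w | tau n.+1 (path_of X w) <> None /\ tau n (path_of X w) <> None])
     = fine (P [set w | tau 1 (path_of X w) <> None /\ tau 0 (path_of X w) <> None])
       * fine (P [set w | tau n (path_of X w) <> None])).

Definition Mp d (T : measurableType d) (R : realType) (P : probability T R)
  (F : nat -> set (set T)) (X : nat -> T -> R) (p : R) : Prop :=
  exists (delta C : R), 0 < delta /\
  exists Z : nat -> T -> \bar R, forall t, (0 < t)%N ->
    is_cexp P (F t) (fun w => (`|X t.+1 w - X t w| `^ p)%:E) (Z t) /\
    {ae P, forall w, (Z t w <= (C * (1 + X t w) `^ (p - 2 - delta))%:E)%E}.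

(* Main.v *)
Require Import Defs.
From HB Require Import structures.
From mathcomp Require Import all_boot all_order all_algebra.
From mathcomp Require Import all_classical all_reals all_analysis.
From mathcomp Require Import measurable_realfun ring lra.
Set Implicit Arguments. Unset Strict Implicit. Unset Printing Implicit Defensive.
Import Order.TTheory GRing.Theory Num.Theory.
Import numFieldNormedType.Exports.
Local Open Scope classical_set_scope.
Local Open Scope ring_scope.

(** With [q := max(2, 1 + r)], both bounds come from the Lyapunov functions
    [f(x) = x^q (log x)^b]. By (A2) and a second-order Taylor expansion, the
    drift of [f(X_t)] at [X_t = z] is, up to a relative error that tends to 0,
      [(s2/2) z^(q-2) (log z)^(b-1) (q (q-1-r) log z + b (2q-1-r))],
    where (M_p) absorbs the Taylor remainder and the large jumps.
    For [b = -1] this is bounded above, so the stopped process satisfies a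
    maximal inequality [P(max_{s<=t} X_s >= x) <= B t / f(x)]. For suitable
    [b > 0] it is bounded below by a positive constant outside a bounded set,
    from which (A1) lets the process escape within a bounded number of steps
    with probability bounded below; hence [f(X_t)] gains a fixed amount on
    average until [X] exceeds [x], and
    [P(max_{s<=t} X_s < x) <= K f(2x) / t]. Borel-Cantelli along [t = 2^k] and
    monotonicity of the running maximum give the almost sure bounds.
    As the state space is locally finite, it suffices to integrate over events
    of [F_t] on which [X_t] is constant; the coefficients of the Taylor
    polynomial are then constants. *)

(** * Power-logarithm functions *)

Section taylor.
Context {R : realType}.
Implicit Types (f h : R -> R) (x z w K M rho : R).

Lemma lipschitz_of_derive_bounded h (dh : R -> R) z rho K :
  (forall x, `|x - z| <= rho -> is_derive x 1 h (dh x)) ->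
  (forall x, `|x - z| <= rho -> `|dh x| <= K) ->
  forall w, `|w - z| <= rho -> `|h w - h z| <= K * `|w - z|.
Proof.
move=> hd hK w wz.
have cont a b : a <= b -> `|a - z| <= rho -> `|b - z| <= rho ->
    exists2 c, `|c - z| <= rho & h b - h a = dh c * (b - a).
  move=> ab az bz.
  have in_rho x : x \in `[a, b] -> `|x - z| <= rho.
    rewrite in_itv/= => /andP[ax xb].
    move: az bz; rewrite !ler_norml => /andP[? ?] /andP[? ?]; apply/andP; split; lra.
  have [x xab| |c /in_rho crho ->] := @MVT_segment _ h dh a b ab; last by exists c.
    by apply: hd; apply/in_rho/subset_itv_oo_cc.
  apply: derivable_within_continuous => x /in_rho /hd dhx.
  exact: ex_derive.
have [zw|/ltW wz'] := leP z w.
- have [|c crho ->] := cont z w zw _ wz.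
    by rewrite subrr normr0 (le_trans _ wz).
  by rewrite normrM ler_wpM2r// hK.
- have [|c crho e] := cont w z wz' wz.
    by rewrite subrr normr0 (le_trans _ wz).
  by rewrite distrC e normrM distrC (distrC w) ler_wpM2r// hK.
Qed.

Lemma taylor2_bound f (f1 f2 f3 : R -> R) z w M :
  (forall x, `|x - z| <= `|w - z| -> is_derive x 1 f (f1 x)) ->
  (forall x, `|x - z| <= `|w - z| -> is_derive x 1 f1 (f2 x)) ->
  (forall x, `|x - z| <= `|w - z| -> is_derive x 1 f2 (f3 x)) ->
  (forall x, `|x - z| <= `|w - z| -> `|f3 x| <= M) ->
  `|f w - (f z + f1 z * (w - z) + f2 z / 2 * (w - z) ^+ 2)|
    <= M * `|w - z| ^+ 3.
Proof.
set rho := `|w - z| => d1 d2 d3 b3.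
have rho0 : 0 <= rho by exact: normr_ge0.
have zz : `|z - z| <= rho by rewrite subrr normr0 normr_ge0.
have M0 : 0 <= M by apply: le_trans (b3 z zz).
have s2 x : `|x - z| <= rho -> `|f2 x - f2 z| <= M * rho.
  move=> xz; apply: le_trans (lipschitz_of_derive_bounded d3 b3 xz) _.
  by rewrite ler_wpM2l.
have s1 x : `|x - z| <= rho ->
    `|f1 x - f1 z - f2 z * (x - z)| <= M * rho ^+ 2.
  move=> xz; have := @lipschitz_of_derive_bounded (fun y => f1 y - f2 z * (y - z))
    (fun y => f2 y - f2 z) z rho (M * rho) _ s2 x xz.
  rewrite subrr mulr0 subr0 => H; rewrite [X in `|X|](_ : _ = f1 x - f2 z * (x - z) - f1 z); last by ring.
  apply: le_trans (H _) _.
    move=> y yz; have := d2 y yz => ?.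
    have -> : f2 y - f2 z = f2 y - (f2 z *: (1 - 0)) by rewrite subr0 /GRing.scale/= mulr1.
    apply: is_deriveB.
  by rewrite expr2 mulrA ler_wpM2l// mulr_ge0.
have := @lipschitz_of_derive_bounded
  (fun y => f y - (f1 z * (y - z) + f2 z / 2 * (y - z) ^+ 2))
    (fun y => f1 y - f1 z - f2 z * (y - z)) z rho (M * rho ^+ 2) _ s1 w (lexx _).
rewrite subrr expr0n/= !mulr0 addr0 subr0 => H.
rewrite [X in `|X|](_ : _ = f w - (f1 z * (w - z) + f2 z / 2 * (w - z) ^+ 2) - f z); last by ring.
apply: le_trans (H _) _; last by rewrite -/rho le_eqVlt; apply/orP; left; apply/eqP; ring.
move=> y yz; have := d1 y yz => ?.
have -> : f1 y - f1 z - f2 z * (y - z) =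
  f1 y - ((f1 z *: (1 - 0)) + (f2 z / 2) *: (((2%:R * (y - z) ^+ 1)) *: (1 - 0))).
  rewrite /GRing.scale/= expr1; lra.
apply: is_deriveB; apply: is_deriveD; apply: is_deriveZ.
have dX : is_derive y 1 (fun x => x - z) (1 - 0) by apply: is_deriveB.
exact: (@is_deriveX R R (fun x => x - z) 2 y 1 (1 - 0) dX).
Qed.

End taylor.

Section power_log.
Context {R : realType}.
Implicit Types (a b q x y z w : R).

Lemma powRD_gt0 x a b : 0 < x -> x `^ (a + b) = x `^ a * x `^ b.
Proof. by move=> x0; rewrite powRD// (gt_eqF x0) implybT. Qed.

Lemma powRB_gt0 x a b : 0 < x -> x `^ (a - b) = x `^ a / x `^ b.
Proof. by move=> x0; rewrite powRB// (gt_eqF x0) implybT. Qed.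

Lemma powR_div x y a : 0 <= x -> 0 <= y -> (x / y) `^ a = x `^ a / y `^ a.
Proof.
by move=> x0 y0; rewrite powRM ?invr_ge0// -powR_inv1// -powRrM mulN1r powRN.
Qed.

Lemma ler_powRl x y a : 0 <= a -> 0 <= x -> x <= y -> x `^ a <= y `^ a.
Proof.
by move=> a0 x0 xy; apply: (ge0_ler_powR a0); rewrite ?nnegrE// (le_trans x0).
Qed.

Definition xl a b x := x `^ a * ln x `^ b.

Lemma xl_ge0 a b x : 0 <= xl a b x.
Proof. by rewrite mulr_ge0// powR_ge0. Qed.

Lemma xl_gt0 a b x : 1 < x -> 0 < xl a b x.
Proof. by move=> x1; rewrite mulr_gt0// powR_gt0 ?ln_gt0// (lt_trans _ x1). Qed.

Lemma is_derive_xl a b x : 1 < x ->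
  is_derive x 1 (xl a b) (a * xl (a - 1) b x + b * xl (a - 1) (b - 1) x).
Proof.
move=> x1; have x0 : 0 < x := lt_trans ltr01 x1.
have l0 : 0 < ln x by rewrite ln_gt0.
have d1 := is_derive1_powR a x0.
have d2 : is_derive x 1 ((@powR R)^~ b \o @ln R) (b * ln x `^ (b - 1) * x^-1).
  apply: is_derive1_comp; first exact: is_derive1_powR.
  exact: is_derive1_ln.
have -> : a * xl (a - 1) b x + b * xl (a - 1) (b - 1) x =
   x `^ a *: (b * ln x `^ (b - 1) * x^-1) + (ln x `^ b) *: (a * x `^ (a - 1)).
  rewrite /xl /GRing.scale/= !powRB_gt0//.
  rewrite !powRr1 ?ltW//; field.
  by rewrite !gt_eqF.
exact: (is_deriveM d1 d2).
Qed.

Lemma powR_le_scale y z a : 0 < z -> z / 2 <= y -> y <= 2 * z ->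
  y `^ a <= 2 `^ `|a| * z `^ a.
Proof.
move=> z0 zy yz.
have y0 : 0 < y by apply: lt_le_trans zy; rewrite divr_gt0.
rewrite -ler_pdivrMr ?powR_gt0// -powR_div ?(ltW z0) ?(ltW y0)//.
have [a0|a0] := ger0P a.
  apply: ler_powRl; rewrite ?divr_ge0 ?(ltW y0) ?(ltW z0)//.
  by rewrite ler_pdivrMr.
have -> : y / z = (z / y)^-1 by rewrite invf_div.
rewrite -(@powR_inv1 _ (z / y)) ?divr_ge0 ?(ltW y0) ?(ltW z0)// -powRrM mulN1r.
apply: ler_powRl; rewrite ?divr_ge0 ?oppr_ge0 ?(ltW y0) ?(ltW z0) ?(ltW a0)//.
by rewrite ler_pdivrMr// mulrC -ler_pdivrMr.
Qed.

Lemma near_mul_ln_powR_le (C a delta : R) : 0 < delta ->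
  \forall z \near +oo, C * ln z `^ a <= z `^ delta.
Proof.
move=> d0; pose k : R := `|a| + 1; pose C' : R := `|C| + 1.
have k0 : 0 < k by rewrite ltr_wpDl.
have C0 : 0 < C' by rewrite ltr_wpDl.
pose th := delta / (2 * k).
have th0 : 0 < th by rewrite divr_gt0// mulr_gt0.
pose D := C' * (th `^ k)^-1.
have D0 : 0 <= D by rewrite mulr_ge0 ?invr_ge0 ?powR_ge0 ?(ltW C0).
near=> z.
have z0 : 0 < z by near: z; apply: nbhs_pinfty_gt; exact: num_real.
have ez : expR 1 <= z by near: z; apply: nbhs_pinfty_ge; exact: num_real.
have l1 : 1 <= ln z.
  by rewrite -[leLHS](@expRK R) ler_ln ?posrE ?expR_gt0.
have le1 : ln z `^ a <= ln z `^ k.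
  by apply: ler_powR => //; rewrite (le_trans (ler_norm _))// lerDl.
have le2 : ln z <= z `^ th / th.
  rewrite ler_pdivlMr// mulrC -ln_powR.
  have := @le_ln1Dx R (z `^ th - 1); rewrite subrKC => H.
  apply: le_trans (H _) _; last by rewrite lerBlDr lerDl.
  by rewrite ltrBrDl subrr powR_gt0.
have le3 : ln z `^ k <= z `^ (delta / 2) * (th `^ k)^-1.
  have -> : z `^ (delta / 2) * (th `^ k)^-1 = (z `^ th / th) `^ k.
    rewrite powR_div ?powR_ge0 ?ltW// -powRrM; congr (_ `^ _ / _).
    by rewrite /th; field; rewrite gt_eqF.
  by apply: ler_powRl; rewrite ?(ltW k0)// (le_trans _ l1).
have le4 : D <= z `^ (delta / 2).
  rewrite (_ : D = (D `^ (2 / delta)) `^ (delta / 2)); last first.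
    by rewrite -powRrM (_ : _ * _ = 1) ?powRr1//; field; rewrite gt_eqF.
  apply: ler_powRl; rewrite ?powR_ge0 ?divr_ge0 ?(ltW d0)//.
apply: (@le_trans _ _ (C' * ln z `^ k)).
  apply: (@le_trans _ _ (C' * ln z `^ a)).
    by rewrite ler_wpM2r ?powR_ge0// (le_trans (ler_norm _))// lerDl.
  by rewrite ler_wpM2l// (ltW C0).
have -> : z `^ delta = z `^ (delta / 2) * z `^ (delta / 2).
  by rewrite -powRD_gt0// -splitr.
apply: (@le_trans _ _ (C' * (z `^ (delta / 2) * (th `^ k)^-1))).
  by apply: ler_wpM2l; [exact: ltW|exact: le3].
by rewrite mulrCA ler_wpM2l// powR_ge0.
Unshelve. all: by end_near. Qed.

End power_log.

Section power_log_taylor.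
Context {R : realType}.
Implicit Types (a b q x y z w : R).

(* The successive derivatives of [xl a b]: the family is closed under
   differentiation. *)
Definition xl1 a b x := a * xl (a - 1) b x + b * xl (a - 1) (b - 1) x.
Definition xl2 a b x := a * xl1 (a - 1) b x + b * xl1 (a - 1) (b - 1) x.
Definition xl3 a b x := a * xl2 (a - 1) b x + b * xl2 (a - 1) (b - 1) x.

Lemma is_derive_xl1 a b x : 1 < x -> is_derive x 1 (xl1 a b) (xl2 a b x).
Proof.
move=> x1; apply: is_deriveD; apply: is_deriveZ; exact: is_derive_xl.
Qed.

Lemma is_derive_xl2 a b x : 1 < x -> is_derive x 1 (xl2 a b) (xl3 a b x).
Proof.
move=> x1; apply: is_deriveD; apply: is_deriveZ; exact: is_derive_xl1.
Qed.

Lemma ln_ge1_gt1 x : 1 <= ln x -> 1 < x.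
Proof. by move=> l1; rewrite ltNge; apply: contraTN l1 => /ln_le0 ?; rewrite -ltNge (le_lt_trans _ ltr01). Qed.

Lemma xl_pred_log_le a b x : 1 <= ln x -> xl a (b - 1) x <= xl a b x.
Proof.
move=> l1; rewrite /xl ler_wpM2l ?powR_ge0// ler_powR// gerBl; exact: ler01.
Qed.

Lemma xl_pred_mul a b x : 0 < x -> xl (a - 1) b x * x = xl a b x.
Proof.
by move=> x0; rewrite /xl powRB_gt0// powRr1 ?ltW// mulrAC divfK// gt_eqF.
Qed.

Lemma norm_comb_le (a b A B M M' : R) : `|A| <= M -> `|B| <= M' ->
  `|a * A + b * B| <= `|a| * M + `|b| * M'.
Proof.
move=> AM BM; apply: le_trans (ler_normD _ _) _.
by rewrite !normrM lerD// ler_wpM2l.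
Qed.

Lemma xl1_bound a b : exists2 K, 0 <= K &
  forall x, 1 <= ln x -> `|xl1 a b x| <= K * xl (a - 1) b x.
Proof.
exists (`|a| + `|b|); first by rewrite addr_ge0.
move=> x l1; rewrite mulrDl; apply: norm_comb_le; rewrite ger0_norm ?xl_ge0//.
exact: xl_pred_log_le.
Qed.

Lemma xl2_bound a b : exists2 K, 0 <= K &
  forall x, 1 <= ln x -> `|xl2 a b x| <= K * xl (a - 1 - 1) b x.
Proof.
have [K K0 HK] := xl1_bound (a - 1) b.
have [K' K'0 HK'] := xl1_bound (a - 1) (b - 1).
exists (`|a| * K + `|b| * K'); first by rewrite addr_ge0// mulr_ge0.
move=> x l1; rewrite mulrDl -!mulrA; apply: norm_comb_le; first exact: HK.
by apply: le_trans (HK' _ l1) _; rewrite ler_wpM2l// xl_pred_log_le.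
Qed.

Lemma xl3_bound a b : exists2 K, 0 <= K &
  forall x, 1 <= ln x -> `|xl3 a b x| <= K * xl (a - 1 - 1 - 1) b x.
Proof.
have [K K0 HK] := xl2_bound (a - 1) b.
have [K' K'0 HK'] := xl2_bound (a - 1) (b - 1).
exists (`|a| * K + `|b| * K'); first by rewrite addr_ge0// mulr_ge0.
move=> x l1; rewrite mulrDl -!mulrA; apply: norm_comb_le; first exact: HK.
by apply: le_trans (HK' _ l1) _; rewrite ler_wpM2l// xl_pred_log_le.
Qed.

Lemma near_ln_ge (l : R) : \forall z \near +oo, l <= ln z.
Proof.
near=> z.
have ez : expR l <= z by near: z; apply: nbhs_pinfty_ge; exact: num_real.
by rewrite -[leLHS](@expRK R) ler_ln ?posrE ?expR_gt0// (lt_le_trans _ ez)// expR_gt0.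
Unshelve. all: by end_near. Qed.

Lemma xl_comparable a b z x : ln 4 <= ln z -> 1 <= ln z -> z / 2 <= x -> x <= 2 * z ->
  xl a b x <= 2 `^ `|a| * 2 `^ `|b| * xl a b z /\ ln z / 2 <= ln x.
Proof.
move=> l4 l1 zx xz.
have z0 : 0 < z := lt_trans ltr01 (ln_ge1_gt1 l1).
have x0 : 0 < x by apply: lt_le_trans zx; rewrite divr_gt0.
have e4 : ln 4 = ln 2 + ln 2 :> R by rewrite -lnM ?posrE//; congr ln; ring.
have lzx : ln z / 2 <= ln x.
  have : ln (z / 2) <= ln x by rewrite ler_ln// posrE divr_gt0.
  rewrite ln_div ?posrE//; lra.
split => //.
have lxz : ln x <= 2 * ln z.
  have : ln x <= ln (2 * z) by rewrite ler_ln// posrE mulr_gt0.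
  rewrite lnM ?posrE//; have : 0 <= ln 2 :> R by rewrite ln_ge0// ler1n.
  lra.
have A1 := powR_le_scale a z0 zx xz.
have A2 := powR_le_scale b (lt_le_trans ltr01 l1) lzx lxz.
rewrite /xl [leRHS](_ : _ = (2 `^ `|a| * z `^ a) * (2 `^ `|b| * ln z `^ b)); last by ring.
by apply: ler_pM; rewrite ?powR_ge0.
Qed.

(* Split according to whether [v <= h]. *)
Lemma cube_le (p h v y : R) : 2 < p -> 0 < h -> 0 <= v -> v <= 1 -> 0 <= y ->
  1 <= h `^ (p - 1) * y -> v ^+ 3 <= h * (v ^+ 2 + y * v `^ p).
Proof.
move=> p2 h0 v0 v1 y0 hy.
have [vh|hv] := leP v h.
  rewrite (exprS v 2); apply: ler_pM => //; first by rewrite exprn_ge0.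
  by rewrite lerDl mulr_ge0 ?powR_ge0.
have vp : 0 < v := lt_trans h0 hv.
apply: (@le_trans _ _ (v ^+ 2)).
  by rewrite (exprS v 2) ler_piMl// exprn_ge0.
have -> : v `^ p = v ^+ 2 * v `^ (p - 2).
  by rewrite -(@powR_mulrn _ v 2)// -powRD_gt0//; congr (_ `^ _); lra.
have hp : h `^ (p - 2) <= v `^ (p - 2).
  by apply: ler_powRl; [lra|exact: ltW|exact: ltW].
have e1 : h `^ (p - 1) = h * h `^ (p - 2).
  rewrite -[X in X * _]powRr1 ?(ltW h0)// -powRD_gt0//; congr (_ `^ _); lra.
have : 1 <= h * y * v `^ (p - 2).
  apply: (le_trans hy); rewrite e1 mulrAC ler_wpM2l// mulr_ge0//; exact: ltW.
move=> H; rewrite mulrDr; apply: ler_wpDl; first by rewrite mulr_ge0 ?exprn_ge0 ?(ltW h0).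
rewrite [leRHS](_ : _ = v ^+ 2 * (h * y * v `^ (p - 2))); last by ring.
by rewrite ler_peMr// exprn_ge0.
Qed.

Definition taylor_xl q b z w :=
  xl q b z + xl1 q b z * (w - z) + xl2 q b z / 2 * (w - z) ^+ 2.

(* In terms of [v = (w - z) / z] the Taylor remainder is of order
   [xl q b z * |v|^3] for small [v] and [xl q b z * |v|^p] for large [v]; the
   factor [z^delta], which (M_p) pays for, makes room for the loss of one
   logarithm and for the arbitrarily small constant [eta]. *)
Definition err_xl q b p delta eta z w :=
  eta * xl q (b - 1) z * (((w - z) / z) ^+ 2 + z `^ delta * `|(w - z) / z| `^ p).

Lemma xl_logpred_mul a b x : 0 < ln x -> xl a (b - 1) x * ln x = xl a b x.
Proof.
by move=> x0; rewrite /xl powRB_gt0// powRr1 ?ltW// -mulrA divfK// gt_eqF.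
Qed.

Lemma near_taylor_xl_small q b (p delta eta : R) : 2 < p -> 0 < delta -> 0 < eta ->
  \forall z \near +oo, forall w, `|w - z| <= z / 2 ->
    `|xl q b w - taylor_xl q b z w| <= err_xl q b p delta eta z w.
Proof.
move=> p2 d0 e0.
have [K0 K00 HK0] := xl3_bound q b.
pose K := K0 * (2 `^ `|q - 1 - 1 - 1| * 2 `^ `|b|) + 1.
have Kp : 0 < K by rewrite ltr_wpDl// !mulr_ge0 ?powR_ge0.
near=> z.
have l4 : ln 4 <= ln z by near: z; exact: near_ln_ge.
have l2 : 2 <= ln z by near: z; exact: near_ln_ge.
have l1 : 1 <= ln z by lra.
have l0 : 0 < ln z by lra.
have nz : (K / eta) `^ (p - 1) * ln z `^ (p - 1) <= z `^ delta.
  by near: z; exact: near_mul_ln_powR_le.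
have z1 := ln_ge1_gt1 l1; have z0 : 0 < z by lra.
move=> w wz.
have rng x : `|x - z| <= `|w - z| -> z / 2 <= x /\ x <= 2 * z.
  move=> /le_trans /(_ wz); rewrite ler_norml => /andP[? ?]; split; lra.
have rng1 x : `|x - z| <= `|w - z| -> 1 <= ln x.
  move=> /rng [h1 h2]; have [_] := xl_comparable 0 0 l4 l1 h1 h2; lra.
have T := @taylor2_bound R (xl q b) (xl1 q b) (xl2 q b) (xl3 q b) z w
  (K * xl (q - 1 - 1 - 1) b z).
rewrite /taylor_xl; apply: le_trans (T _ _ _ _) _.
- by move=> x /rng1 /ln_ge1_gt1; exact: is_derive_xl.
- by move=> x /rng1 /ln_ge1_gt1; exact: is_derive_xl1.
- by move=> x /rng1 /ln_ge1_gt1; exact: is_derive_xl2.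
- move=> x xw; apply: le_trans (HK0 x (rng1 x xw)) _.
  have [h1 h2] := rng x xw.
  have [h3 _] := xl_comparable (q - 1 - 1 - 1) b l4 l1 h1 h2.
  apply: (@le_trans _ _ (K0 * (2 `^ `|q - 1 - 1 - 1| * 2 `^ `|b|) * xl (q - 1 - 1 - 1) b z)).
    by rewrite -(mulrA K0) ler_wpM2l.
  by rewrite ler_wpM2r ?xl_ge0// lerDl.
set v := `|(w - z) / z|.
have v0 : 0 <= v by exact: normr_ge0.
have wv : `|w - z| = z * v by rewrite /v normrM normfV (gtr0_norm z0) mulrC divfK// gt_eqF.
have v12 : v <= 1.
  by rewrite /v normrM normfV (gtr0_norm z0) ler_pdivrMr// mul1r (le_trans wz)//; lra.
pose h := eta / (K * ln z).
have hp : 0 < h by rewrite divr_gt0// mulr_gt0.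
have H := @cube_le p h v (z `^ delta) p2 hp v0 v12 (powR_ge0 _ _).
have {}H : v ^+ 3 <= h * (v ^+ 2 + z `^ delta * v `^ p).
  apply: H; apply: (@le_trans _ _ (h `^ (p - 1) * ((K / eta) `^ (p - 1) * ln z `^ (p - 1)))).
    rewrite -powRM ?divr_ge0 ?(ltW Kp) ?(ltW l0) ?(ltW e0)//.
    rewrite -powRM ?(ltW hp) ?mulr_ge0 ?invr_ge0 ?(ltW Kp) ?(ltW l0) ?(ltW e0)//.
    have -> : h * (K / eta * ln z) = 1 by rewrite /h; field; rewrite !gt_eqF.
    by rewrite powR1.
  by rewrite ler_wpM2l// powR_ge0.
rewrite /err_xl -/v wv exprMn.
have -> : ((w - z) / z) ^+ 2 = v ^+ 2 by rewrite /v real_normK// num_real.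
have -> : K * xl (q - 1 - 1 - 1) b z * (z ^+ 3 * v ^+ 3) = K * xl q b z * v ^+ 3.
  by rewrite -(xl_pred_mul q b z0) -(xl_pred_mul (q - 1) b z0) -(xl_pred_mul (q - 1 - 1) b z0); ring.
have -> : eta * xl q (b - 1) z * (v ^+ 2 + z `^ delta * v `^ p) =
   K * xl q b z * (h * (v ^+ 2 + z `^ delta * v `^ p)).
  by rewrite -(xl_logpred_mul q b l0) /h; field; rewrite !gt_eqF.
by rewrite ler_wpM2l// mulr_ge0 ?powR_ge0 ?xl_ge0// ltW.
Unshelve. all: by end_near. Qed.

Lemma near_taylor_xl_large q b (p delta eta : R) : 2 < p -> 0 < delta -> 0 < eta ->
  \forall z \near +oo, forall w, z / 2 < `|w - z| ->
    `|taylor_xl q b z w| <= err_xl q b p delta eta z w.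
Proof.
move=> p2 d0 e0.
have [K1 K10 HK1] := xl1_bound q b.
have [K2 K20 HK2] := xl2_bound q b.
pose K := 4 + 2 * K1 + K2.
near=> z.
have l2 : 2 <= ln z by near: z; exact: near_ln_ge.
have l1 : 1 <= ln z by lra.
have l0 : 0 < ln z by lra.
have nz : (K * 2 `^ (p - 2) / eta) * ln z `^ 1 <= z `^ delta.
  by near: z; exact: near_mul_ln_powR_le.
have z1 := ln_ge1_gt1 l1; have z0 : 0 < z by lra.
move=> w wz.
rewrite /err_xl; set v := `|(w - z) / z|.
have wv : `|w - z| = z * v by rewrite /v normrM normfV (gtr0_norm z0) mulrC divfK// gt_eqF.
have v12 : 1 / 2 < v by rewrite /v normrM normfV (gtr0_norm z0) ltr_pdivlMr//; lra.
have v0 : 0 < v by lra.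
have -> : ((w - z) / z) ^+ 2 = v ^+ 2 by rewrite /v real_normK// num_real.
have Tb : `|taylor_xl q b z w| <= K * xl q b z * v ^+ 2.
  apply: (@le_trans _ _ (xl q b z + (K1 * xl q b z) * v + (K2 * xl q b z) * v ^+ 2)).
    rewrite /taylor_xl; apply: le_trans (ler_normD _ _) _.
    apply: lerD; last first.
      rewrite normrM normrX wv exprMn normrM.
      rewrite -(xl_pred_mul q b z0) -(xl_pred_mul (q - 1) b z0).
      have H2 := HK2 z l1.
      rewrite [leRHS](_ : _ = (K2 * xl (q - 1 - 1) b z) * (z ^+ 2 * v ^+ 2)); last by ring.
      rewrite ler_wpM2r ?mulr_ge0 ?exprn_ge0 ?(ltW z0) ?(ltW v0)//.
      apply: le_trans H2; rewrite (@ger0_norm _ 2^-1) ?invr_ge0//.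
      by apply: ler_piMr; [exact: normr_ge0|lra].
    apply: le_trans (ler_normD _ _) _; apply: lerD; first by rewrite ger0_norm ?xl_ge0.
    rewrite normrM wv -(xl_pred_mul q b z0) mulrA mulrA ler_wpM2r ?(ltW v0)//.
    by rewrite ler_wpM2r ?HK1 ?(ltW z0).
  rewrite [leLHS](_ : _ = xl q b z * (1 + K1 * v + K2 * v ^+ 2)); last by ring.
  rewrite [leRHS](_ : _ = xl q b z * (K * v ^+ 2)); last by ring.
  rewrite ler_wpM2l ?xl_ge0// /K.
  have h1 : 0 <= K1 * (v * (2 * v - 1)).
    by rewrite mulr_ge0// mulr_ge0 ?(ltW v0)//; lra.
  have h2 : 1 <= 4 * v ^+ 2 by nra.
  rewrite [leRHS](_ : _ = 4 * v ^+ 2 + K1 * v + K1 * (v * (2 * v - 1)) + K2 * v ^+ 2); last by ring.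
  lra.
apply: (le_trans Tb).
have vp : v ^+ 2 <= 2 `^ (p - 2) * v `^ p.
  have -> : v `^ p = v ^+ 2 * v `^ (p - 2).
    by rewrite -(@powR_mulrn _ v 2) ?(ltW v0)// -powRD_gt0//; congr (_ `^ _); lra.
  rewrite mulrCA ler_peMr ?exprn_ge0 ?(ltW v0)//.
  rewrite -powRM ?(ltW v0)// -[leLHS](@powRr0 _ (2 * v)) ler_powR//; lra.
rewrite -(xl_logpred_mul q b l0).
move: nz; rewrite powRr1 ?(ltW l0)// => nz.
rewrite [leLHS](_ : _ = eta * xl q (b - 1) z * (K * ln z * v ^+ 2 / eta)); last first.
  by field; rewrite gt_eqF.
rewrite ler_wpM2l ?mulr_ge0 ?powR_ge0 ?xl_ge0 ?(ltW e0)//.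
apply: ler_wpDl; first by rewrite exprn_ge0// ltW.
apply: (@le_trans _ _ (K * ln z * (2 `^ (p - 2) * v `^ p) / eta)).
  rewrite ler_pM2r ?invr_gt0// ler_wpM2l// mulr_ge0 ?(ltW l0)// /K; lra.
rewrite [leLHS](_ : _ = K * 2 `^ (p - 2) / eta * ln z * v `^ p); last by ring.
by rewrite ler_wpM2r ?powR_ge0.
Unshelve. all: by end_near. Qed.

Lemma near_powR_le_err q b (p delta eta : R) : q <= p -> 0 < delta -> 0 < eta ->
  \forall z \near +oo, forall w, z / 2 < `|w - z| ->
    (3 * `|w - z|) `^ q <= err_xl q b p delta eta z w.
Proof.
move=> qp d0 e0.
near=> z.
have l2 : 2 <= ln z by near: z; exact: near_ln_ge.
have l1 : 1 <= ln z by lra.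
have l0 : 0 < ln z by lra.
have nz : (3 `^ q * 2 `^ (p - q) / eta) * ln z `^ (1 - b) <= z `^ delta.
  by near: z; exact: near_mul_ln_powR_le.
have z1 := ln_ge1_gt1 l1; have z0 : 0 < z by lra.
move=> w wz.
rewrite /err_xl; set v := `|(w - z) / z|.
have wv : `|w - z| = z * v by rewrite /v normrM normfV (gtr0_norm z0) mulrC divfK// gt_eqF.
have v12 : 1 / 2 < v by rewrite /v normrM normfV (gtr0_norm z0) ltr_pdivlMr//; lra.
have v0 : 0 < v by lra.
rewrite wv !powRM ?mulr_ge0 ?(ltW z0) ?(ltW v0)//.
have vp : v `^ q <= 2 `^ (p - q) * v `^ p.
  have -> : v `^ p = v `^ q * v `^ (p - q).
    by rewrite -powRD_gt0//; congr (_ `^ _); lra.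
  rewrite mulrCA ler_peMr ?powR_ge0//.
  rewrite -powRM ?(ltW v0)// -[leLHS](@powRr0 _ (2 * v)) ler_powR//; lra.
have elog : ln z `^ (b - 1) * ln z `^ (1 - b) = 1.
  by rewrite -powRD_gt0// (_ : _ + _ = 0) ?powRr0//; ring.
apply: (@le_trans _ _ (eta * xl q (b - 1) z * (z `^ delta * v `^ p))); last first.
  rewrite ler_wpM2l ?mulr_ge0 ?powR_ge0 ?xl_ge0 ?(ltW e0)//.
  by apply: ler_wpDl => //; exact: sqr_ge0.
apply: (@le_trans _ _ (eta * xl q (b - 1) z * ((3 `^ q * 2 `^ (p - q) / eta) * ln z `^ (1 - b) * v `^ p))); last first.
  rewrite ler_wpM2l ?mulr_ge0 ?powR_ge0 ?xl_ge0 ?(ltW e0)//.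
  by rewrite ler_wpM2r ?powR_ge0.
rewrite /xl [leRHS](_ : _ = 3 `^ q * z `^ q * (2 `^ (p - q) * v `^ p) * (ln z `^ (b - 1) * ln z `^ (1 - b))); last first.
  by field; rewrite gt_eqF.
by rewrite elog mulr1 mulrA ler_wpM2l// mulr_ge0 ?powR_ge0.
Unshelve. all: by end_near. Qed.

End power_log_taylor.

Section drift.
Context {R : realType}.
Implicit Types (q b p z : R).

Definition drift_coef (s2 c q b l : R) :=
  (q * c + q * (q - 1) * s2 / 2) * l + b * (c + (2 * q - 1) * s2 / 2).

Lemma xl1E q b z : 1 <= ln z ->
  xl1 q b z = z * xl (q - 2) (b - 1) z * (q * ln z + b).
Proof.
move=> l1; have l0 : 0 < ln z by lra.
have z0 : 0 < z := lt_trans ltr01 (ln_ge1_gt1 l1).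
rewrite /xl1 -(xl_logpred_mul (q - 1) b l0) -(xl_pred_mul (q - 1) (b - 1) z0).
by rewrite (_ : q - 1 - 1 = q - 2); ring.
Qed.

Lemma xl2E q b z : 1 <= ln z ->
  xl2 q b z = xl (q - 2) (b - 1) z *
    (q * (q - 1) * ln z + b * (2 * q - 1) + b * (b - 1) / ln z).
Proof.
move=> l1; have l0 : 0 < ln z by lra.
have z0 : 0 < z := lt_trans ltr01 (ln_ge1_gt1 l1).
rewrite /xl2 /xl1 (_ : q - 1 - 1 = q - 2); last by ring.
rewrite -(xl_logpred_mul (q - 2) b l0) -(xl_logpred_mul (q - 2) (b - 1) l0).
by field; rewrite gt_eqF.
Qed.

(* [pi], [E1], [E2], [Ep] stand for the probability of an event on which
   [X_t = z] and for the integrals of [D], [D^2], [|D|^p] over it, where [D] is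
   the increment; the second summand is then the integral of [err_xl]. *)
Lemma near_drift (q b p delta s2 c Cp th : R) : 0 < s2 -> 0 < th ->
  exists2 e, 0 < e & exists2 eta, 0 < eta &
  \forall z \near +oo, forall pi E1 E2 Ep : R, 0 <= pi ->
    `|E1 - c / z * pi| <= e / (z * ln z) * pi ->
    `|E2 - s2 * pi| <= e / ln z * pi ->
    Ep <= Cp * (1 + z) `^ (p - 2 - delta) * pi ->
    `|xl1 q b z * E1 + xl2 q b z / 2 * E2
       - pi * xl (q - 2) (b - 1) z * drift_coef s2 c q b (ln z)|
    + eta * xl q (b - 1) z * (E2 / z ^+ 2 + z `^ delta * (Ep / z `^ p))
    <= th * pi * xl (q - 2) (b - 1) z.
Proof.
move=> s20 th0.
pose K : R := (`|q| + `|b|) + (`|q * (q - 1)| + `|b * (2 * q - 1)| + `|b * (b - 1)|) / 2 + 1.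
have K1 : 1 <= K by rewrite lerDr addr_ge0 ?divr_ge0 ?addr_ge0.
pose A : R := `|Cp| * 2 `^ `|p - 2 - delta|.
have A0 : 0 <= A by rewrite mulr_ge0 ?powR_ge0.
pose e : R := Num.min 1 (th / (4 * K)).
have e0 : 0 < e by rewrite lt_min ltr01 divr_gt0//; lra.
have e1 : e <= 1 by rewrite ge_min lexx.
have eK : e * K <= th / 4.
  have : e <= th / (4 * K) by rewrite ge_min lexx orbT.
  rewrite ler_pdivlMr; lra.
pose B := s2 + 1 + A.
have B0 : 0 < B by rewrite /B; lra.
exists e => //; exists (th / (4 * B)); first by rewrite divr_gt0//; lra.
near=> z.
have l2 : 2 <= ln z by near: z; exact: near_ln_ge.
have lb : `|b * (b - 1)| * s2 / th <= ln z by near: z; exact: near_ln_ge.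
have l1 : 1 <= ln z by lra.
have l0 : 0 < ln z by lra.
have z1 := ln_ge1_gt1 l1; have z0 : 0 < z by lra.
move=> pi E1 E2 Ep pi0 h1 h2 h3.
rewrite xl1E// xl2E//.
have -> : xl q (b - 1) z = z ^+ 2 * xl (q - 2) (b - 1) z.
  rewrite -(xl_pred_mul q (b - 1) z0) -(xl_pred_mul (q - 1) (b - 1) z0).
  by rewrite (_ : q - 1 - 1 = q - 2); ring.
have := xl_ge0 (q - 2) (b - 1) z; move: (xl _ _ _) => Y Y0.
have zne : z != 0 by rewrite gt_eqF.
have lne : ln z != 0 by rewrite gt_eqF.
set D1 := E1 - _ in h1; set D2 := E2 - _ in h2.
rewrite [X in `|X|](_ : _ = Y * (z * (q * ln z + b) * D1)
   + Y * ((q * (q - 1) * ln z + b * (2 * q - 1) + b * (b - 1) / ln z) / 2 * D2)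
   + Y * (pi * (b * (b - 1) * s2 / 2 / ln z))); last first.
  by rewrite /D1 /D2 /drift_coef; field; rewrite ?zne ?lne.
have il1 : (ln z)^-1 <= 1 by rewrite invf_le1.
have b1 : `|z * (q * ln z + b) * D1| <= (`|q| + `|b|) * (e * pi).
  rewrite normrM (_ : (`|q| + `|b|) * (e * pi) = (z * ln z * (`|q| + `|b|)) * (e / (z * ln z) * pi)); last first.
    by field; rewrite ?zne ?lne.
  apply: ler_pM => //; rewrite normrM (gtr0_norm z0) -mulrA ler_wpM2l ?(ltW z0)//.
  apply: le_trans (ler_normD _ _) _; rewrite normrM (gtr0_norm l0) mulrDr mulrC lerD2l.
  by rewrite ler_peMl.
have b2 : `|(q * (q - 1) * ln z + b * (2 * q - 1) + b * (b - 1) / ln z) / 2 * D2|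
   <= ((`|q * (q - 1)| + `|b * (2 * q - 1)| + `|b * (b - 1)|) / 2) * (e * pi).
  rewrite normrM [leRHS](_ : _ = (((`|q * (q - 1)| + `|b * (2 * q - 1)| + `|b * (b - 1)|) * ln z) / 2) * (e / ln z * pi)); last first.
    by field.
  apply: ler_pM => //; rewrite normrM (@ger0_norm _ 2^-1) ?invr_ge0// ler_wpM2r ?invr_ge0//.
  apply: le_trans (ler_normD _ _) _; rewrite !mulrDl; apply: lerD.
    apply: le_trans (ler_normD _ _) _; apply: lerD.
      by rewrite (normrM _ (ln z)) (gtr0_norm l0).
    by rewrite ler_peMr.
  rewrite (normrM _ (ln z)^-1) ler_wpM2l// ger0_norm ?invr_ge0 ?(ltW l0)//; lra.
have b3 : `|pi * (b * (b - 1) * s2 / 2 / ln z)| <= th / 2 * pi.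
  rewrite normrM (ger0_norm pi0) mulrC ler_wpM2r//.
  rewrite [X in `|X|](_ : _ = b * (b - 1) * (s2 / 2 / ln z)); last by ring.
  rewrite normrM [X in _ * X]ger0_norm ?divr_ge0 ?(ltW s20) ?(ltW l0)//.
  move: lb; rewrite ler_pdivrMr// => lb.
  rewrite [leLHS](_ : _ = (`|b * (b - 1)| * s2) / 2 / ln z); last by ring.
  by rewrite ler_pdivrMr// ; lra.
have b4 : E2 + z `^ delta * z ^+ 2 * (Ep / z `^ p) <= B * pi.
  rewrite /B mulrDl; apply: lerD.
    move: h2; rewrite ler_norml => /andP[_]; rewrite /D2 => h2.
    have : e / ln z * pi <= 1 * pi.
      by rewrite ler_wpM2r// ler_pdivrMr//; lra.
    lra.
  have zp0 := powR_gt0 p z0.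
  rewrite mulrA ler_pdivrMr//.
  have sc := @powR_le_scale R (1 + z) z (p - 2 - delta) z0.
  have {}sc : (1 + z) `^ (p - 2 - delta) <= 2 `^ `|p - 2 - delta| * z `^ (p - 2 - delta).
    by apply: sc; lra.
  have h4 : Ep <= `|Cp| * (2 `^ `|p - 2 - delta| * z `^ (p - 2 - delta)) * pi.
    apply: (le_trans h3); rewrite ler_wpM2r//.
    apply: (@le_trans _ _ (`|Cp| * (1 + z) `^ (p - 2 - delta))).
      by rewrite ler_wpM2r ?powR_ge0// ler_norm.
    by rewrite ler_wpM2l.
  have zz : z `^ delta * z ^+ 2 * z `^ (p - 2 - delta) = z `^ p.
    rewrite -(@powR_mulrn _ z 2) ?(ltW z0)// -!powRD_gt0//; congr (_ `^ _); lra.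
  rewrite -zz [leRHS](_ : _ = (z `^ delta * z ^+ 2) * (`|Cp| * (2 `^ `|p - 2 - delta| * z `^ (p - 2 - delta)) * pi)); last first.
    by rewrite /A; ring.
  by rewrite ler_wpM2l// mulr_ge0 ?powR_ge0 ?exprn_ge0 ?(ltW z0).
have -> : th / (4 * B) * (z ^+ 2 * Y) * (E2 / z ^+ 2 + z `^ delta * (Ep / z `^ p))
    = Y * (th / (4 * B) * (E2 + z `^ delta * z ^+ 2 * (Ep / z `^ p))).
  by field; rewrite zne gt_eqF ?powR_gt0//; rewrite gt_eqF//.
have -> : th * pi * Y = Y * (th / 4 * pi + th / 2 * pi + th / 4 * pi) by field.
rewrite -!mulrDr normrM (ger0_norm Y0) -mulrDr ler_wpM2l//.
apply: lerD.
  apply: le_trans (ler_normD _ _) _; apply: lerD => //.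
  apply: le_trans (ler_normD _ _) _; apply: le_trans (lerD b1 b2) _.
  rewrite -mulrDl.
  apply: (@le_trans _ _ (K * (e * pi))).
    by rewrite ler_wpM2r ?mulr_ge0 ?(ltW e0)// lerDl.
  by rewrite mulrA ler_wpM2r// mulrC.
rewrite [leRHS](_ : _ = th / (4 * B) * (B * pi)); last by field; rewrite gt_eqF.
by rewrite ler_wpM2l// divr_ge0 ?(ltW th0)// mulr_ge0 ?(ltW B0).
Unshelve. all: by end_near. Qed.

End drift.

(** * Conditional moments *)

Section sub_sigma_algebra.
Context {T : Type} {G : set (set T)}.
Hypothesis sG : sigma_algebra setT G.

Lemma sub_sigma0 : G set0. Proof. by case: sG. Qed.

Lemma sub_sigmaC A : G A -> G (~` A).
Proof. by case: sG => _ C _ /C; rewrite setTD. Qed.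

Lemma sub_sigmaT : G setT.
Proof. by rewrite -setC0; apply: sub_sigmaC; exact: sub_sigma0. Qed.

Lemma sub_sigmaU A B : G A -> G B -> G (A `|` B).
Proof.
case: sG => G0 _ U GA GB; rewrite -bigcup2E; apply: U => -[|[|n]]//=.
Qed.

Lemma sub_sigmaI A B : G A -> G B -> G (A `&` B).
Proof.
by move=> GA GB; rewrite -[_ `&` _]setCK setCI; apply/sub_sigmaC/sub_sigmaU; exact: sub_sigmaC.
Qed.

End sub_sigma_algebra.

Section conditional_expectation.
Context {d : measure_display} {T : measurableType d} {R : realType}.
Variables (P : probability T R) (G : set (set T)).
Hypothesis GM : G `<=` measurable.
Implicit Types (Y : T -> R) (Z : T -> \bar R) (A : set T).

Lemma G_meas_measurable_fun d' (U : measurableType d') (f : T -> U) A :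
  G_meas G f -> measurable A -> measurable_fun A f.
Proof.
by move=> Gf mA _ B mB; apply: measurableI => //; apply/GM/Gf.
Qed.

Lemma fin_num_probability A : measurable A -> P A \is a fin_num.
Proof. by move=> mA; rewrite fin_num_measure. Qed.

Lemma integral_cst_fine A (k : R) : measurable A ->
  (\int[P]_(w in A) cst k%:E w = (k * fine (P A))%:E)%E.
Proof.
by move=> mA; rewrite integral_cst// EFinM fineK// fin_num_probability.
Qed.

Lemma cexp_integrable Y Z A (k : R) :
  measurable_fun setT Y -> (forall w, 0 <= Y w) -> is_cexp P G (EFin \o Y) Z ->
  G A -> {ae P, forall w, A w -> (Z w <= k%:E)%E} ->
  P.-integrable A (EFin \o Y).
Proof.
move=> mY Y0 [GZ Z0 YZ] GA Zk.
have mA := GM GA.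
have mYA : measurable_fun A (EFin \o Y).
  by apply/measurable_EFinP; apply: measurable_funS mY.
apply/integrableP; split => //.
under eq_integral do rewrite gee0_abs ?lee_fin//.
rewrite YZ//.
apply: (@le_lt_trans _ _ (\int[P]_(w in A) cst `|k|%:E w)%E).
  apply: ae_ge0_le_integral => //.
  - exact: G_meas_measurable_fun.
  - by move=> w _; rewrite lee_fin.
  - apply: filterS Zk => w H Aw; apply: (le_trans (H Aw)).
    by rewrite lee_fin ler_norm.
by rewrite integral_cst_fine// ltry.
Qed.

Lemma cexp_le Y1 Y2 Z1 Z2 A (k1 k2 : R) :
  (forall w, 0 <= Y1 w) -> (forall w, 0 <= Y2 w) ->
  P.-integrable A (EFin \o Y1) -> P.-integrable A (EFin \o Y2) ->
  is_cexp P G (EFin \o Y1) Z1 -> is_cexp P G (EFin \o Y2) Z2 ->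
  0 <= k1 -> 0 <= k2 -> G A ->
  {ae P, forall w, A w -> (Z1 w + k1%:E <= Z2 w + k2%:E)%E} ->
  \int[P]_(w in A) Y1 w + k1 * fine (P A)
    <= \int[P]_(w in A) Y2 w + k2 * fine (P A).
Proof.
move=> Y10 Y20 I1 I2 [GZ1 Z10 YZ1] [GZ2 Z20 YZ2] k10 k20 GA H.
have mA := GM GA.
have : (\int[P]_(w in A) (Z1 w + cst k1%:E w) <= \int[P]_(w in A) (Z2 w + cst k2%:E w))%E.
  apply: ae_ge0_le_integral => //.
  - by move=> w _; rewrite adde_ge0// lee_fin.
  - by apply: emeasurable_funD => //; exact: G_meas_measurable_fun.
  - by move=> w _; rewrite adde_ge0// lee_fin.
  - by apply: emeasurable_funD => //; exact: G_meas_measurable_fun.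
rewrite !ge0_integralD//; try (by move=> w _; rewrite lee_fin);
  try exact: G_meas_measurable_fun.
rewrite -YZ1// -YZ2// !integral_cst_fine//.
rewrite /Rintegral -(fineK (integrable_fin_num mA I1)) -(fineK (integrable_fin_num mA I2)).
by rewrite -!EFinD lee_fin.
Qed.

Lemma is_cexp0 : sigma_algebra setT G -> is_cexp P G (EFin \o (fun=> 0)) (fun=> 0%E).
Proof.
move=> sG; split => // B mB.
rewrite (_ : _ @^-1` _ = if (0%E : \bar R) \in B then setT else set0).
  by case: ifP => _; [exact: sub_sigmaT|exact: sub_sigma0].
apply/seteqP; split => w /=; case: ifPn => //; rewrite ?inE ?notin_setE//.
Qed.

Lemma cexp_ub Y Z A (k : R) : sigma_algebra setT G ->
  (forall w, 0 <= Y w) -> P.-integrable A (EFin \o Y) ->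
  is_cexp P G (EFin \o Y) Z -> G A ->
  {ae P, forall w, A w -> (Z w <= k%:E)%E} ->
  \int[P]_(w in A) Y w <= `|k| * fine (P A).
Proof.
move=> sG Y0 IY cY GA H; have mA := GM GA.
have := @cexp_le Y (fun=> 0) Z (fun=> 0%E) A 0 `|k| Y0 (fun=> lexx _) IY.
rewrite (_ : \int[P]_(w in A) 0 = 0); last by rewrite Rintegral_cst// mul0r.
rewrite mul0r (addr0 (\int[P]_(w in A) Y w)) (add0r (`|k| * _)) => H'; apply: H' => //.
- exact: integrable0.
- exact: is_cexp0.
- apply: filterS H => w H /H; rewrite adde0 add0e => /le_trans; apply.
  by rewrite lee_fin ler_norm.
Qed.

End conditional_expectation.

Section moments.
Context {d : measure_display} {T : measurableType d} {R : realType}.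
Variables (P : probability T R) (G : set (set T)).
Hypothesis GM : G `<=` measurable.
Hypothesis sG : sigma_algebra setT G.
Implicit Types (Y : T -> R) (Z : T -> \bar R) (A : set T).

Lemma cexp_diff_ub Yp Yn Zp Zn A (a : R) :
  (forall w, 0 <= Yp w) -> (forall w, 0 <= Yn w) ->
  P.-integrable A (EFin \o Yp) -> P.-integrable A (EFin \o Yn) ->
  is_cexp P G (EFin \o Yp) Zp -> is_cexp P G (EFin \o Yn) Zn -> G A ->
  {ae P, forall w, A w -> [/\ Zp w \is a fin_num, Zn w \is a fin_num &
     fine (Zp w) - fine (Zn w) <= a]} ->
  \int[P]_(w in A) Yp w - \int[P]_(w in A) Yn w <= a * fine (P A).
Proof.
move=> Yp0 Yn0 Ip In cp cn GA H.
(* [cexp_le] needs nonnegative constants, hence the shift by [`|a|]. *)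
have aa : 0 <= `|a| + a by rewrite -lerBlDr sub0r -normrN ler_norm.
have := cexp_le GM Yp0 Yn0 Ip In cp cn (normr_ge0 a) aa GA.
move=> /(_ _); rewrite mulrDl => H'.
suff : \int[P]_(w in A) Yp w + `|a| * fine (P A) <= \int[P]_(w in A) Yn w + (`|a| * fine (P A) + a * fine (P A)) by lra.
apply: H'; apply: filterS H => w H /H [fp fn].
rewrite -[Zp w]fineK// -[Zn w]fineK// -!EFinD lee_fin /=; lra.
Qed.

Lemma Rintegral_poly A (D : T -> R) (p a0 a1 a2 a3 : R) : measurable A ->
  P.-integrable A (EFin \o D) ->
  P.-integrable A (EFin \o (fun w => D w ^+ 2)) ->
  P.-integrable A (EFin \o (fun w => `|D w| `^ p)) ->
  P.-integrable A (EFin \o (fun w => a0 + a1 * D w + a2 * D w ^+ 2 + a3 * `|D w| `^ p)) /\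
  \int[P]_(w in A) (a0 + a1 * D w + a2 * D w ^+ 2 + a3 * `|D w| `^ p) =
  a0 * fine (P A) + a1 * \int[P]_(w in A) D w + a2 * \int[P]_(w in A) (D w ^+ 2)
    + a3 * \int[P]_(w in A) (`|D w| `^ p).
Proof.
move=> mA I1 I2 I3.
have J0 : P.-integrable A (EFin \o (fun=> a0)).
  by apply: (finite_measure_integrable_cst P a0 mA).
have J1 : P.-integrable A (EFin \o (fun w => a1 * D w)).
  by apply: eq_integrable (integrableZl mA a1 I1).
have J2 : P.-integrable A (EFin \o (fun w => a2 * D w ^+ 2)).
  by apply: eq_integrable (integrableZl mA a2 I2).
have J3 : P.-integrable A (EFin \o (fun w => a3 * `|D w| `^ p)).
  by apply: eq_integrable (integrableZl mA a3 I3).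
have J01 : P.-integrable A (EFin \o (fun w => a0 + a1 * D w)).
  by apply: eq_integrable (integrableD mA J0 J1).
have J012 : P.-integrable A (EFin \o (fun w => a0 + a1 * D w + a2 * D w ^+ 2)).
  by apply: eq_integrable (integrableD mA J01 J2).
split; first by apply: eq_integrable (integrableD mA J012 J3).
rewrite (RintegralD mA J012 J3) (RintegralD mA J01 J2) (RintegralD mA J0 J1).
by rewrite !RintegralZl// Rintegral_cst.
Qed.

End moments.

Section process.
Context {d : measure_display} {T : measurableType d} {R : realType}.
Variables (P : probability T R) (F : nat -> set (set T)) (X : nat -> T -> R).
Hypotheses (filtF : is_filtration F) (adX : adapted F X).

Lemma filtration_sigma t : (0 < t)%N -> sigma_algebra setT (F t).
Proof. by move=> /filtF []. Qed.

Lemma filtration_measurable t : (0 < t)%N -> F t `<=` measurable.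
Proof. by move=> /filtF []. Qed.

Lemma filtration_mono s t : (0 < s)%N -> (s <= t)%N -> F s `<=` F t.
Proof.
move=> s0; elim: t => [|t IH]; first by rewrite leqNgt s0.
rewrite leq_eqVlt => /predU1P[<-//|]; rewrite ltnS => st.
apply: subset_trans (IH st) _.
by have [] := filtF (leq_trans s0 st).
Qed.

Lemma measurable_process t : (0 < t)%N -> measurable_fun setT (X t).
Proof.
move=> t0; apply: (G_meas_measurable_fun (filtration_measurable t0)) => //.
exact: adX.
Qed.

Lemma filtration_level t (B : set R) : (0 < t)%N -> measurable B ->
  F t (X t @^-1` B).
Proof. by move=> t0 mB; exact: adX. Qed.

Lemma measurable_increment t : (0 < t)%N ->
  measurable_fun setT (fun w => X t.+1 w - X t w).
Proof. by move=> t0; apply: measurable_funB; exact: measurable_process. Qed.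

Lemma Mp_step (p delta C : R) (Z : nat -> T -> \bar R) :
  (forall t, (0 < t)%N ->
    is_cexp P (F t) (fun w => (`|X t.+1 w - X t w| `^ p)%:E) (Z t) /\
    {ae P, forall w, (Z t w <= (C * (1 + X t w) `^ (p - 2 - delta))%:E)%E}) ->
  forall t z A, (0 < t)%N -> F t A -> A `<=` [set w | X t w = z] ->
  P.-integrable A (EFin \o (fun w => `|X t.+1 w - X t w| `^ p)) /\
  \int[P]_(w in A) (`|X t.+1 w - X t w| `^ p) <=
    `|C| * (1 + z) `^ (p - 2 - delta) * fine (P A).
Proof.
move=> HM t z A t0 FA Az; have [cZ bZ] := HM t t0.
have mF := filtration_measurable t0.
have bZ' : {ae P, forall w, A w -> (Z t w <= (C * (1 + z) `^ (p - 2 - delta))%:E)%E}.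
  by apply: filterS bZ => w + /Az <-.
have I : P.-integrable A (EFin \o (fun w => `|X t.+1 w - X t w| `^ p)).
  apply: (cexp_integrable mF _ _ cZ FA bZ'); last by move=> w; exact: powR_ge0.
  apply: (measurableT_comp (measurable_powR p)).
  exact/measurableT_comp/measurable_increment.
split => //.
have := cexp_ub mF (filtration_sigma t0) _ I cZ FA bZ'.
by rewrite normrM (@ger0_norm _ (_ `^ _)) ?powR_ge0//; apply => w; exact: powR_ge0.
Qed.

Lemma A2_step (c s2 e x0 : R) (Zp Zn Z2 : T -> \bar R) t : (0 < t)%N ->
  is_cexp P (F t) (fun w => (Num.max (X t.+1 w - X t w) 0)%:E) Zp ->
  is_cexp P (F t) (fun w => (Num.max (X t w - X t.+1 w) 0)%:E) Zn ->
  is_cexp P (F t) (fun w => ((X t.+1 w - X t w) ^+ 2)%:E) Z2 ->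
  {ae P, forall w, x0 <= X t w ->
        [/\ Zp w \is a fin_num, Zn w \is a fin_num, Z2 w \is a fin_num,
            `|fine (Zp w) - fine (Zn w) - c / X t w| <= e / (X t w * ln (X t w)) &
            `|fine (Z2 w) - s2| <= e / ln (X t w)]} ->
  forall z A, x0 <= z -> F t A -> A `<=` [set w | X t w = z] ->
  [/\ P.-integrable A (EFin \o (fun w => X t.+1 w - X t w)),
      P.-integrable A (EFin \o (fun w => (X t.+1 w - X t w) ^+ 2)),
      `|\int[P]_(w in A) (X t.+1 w - X t w) - c / z * fine (P A)|
         <= e / (z * ln z) * fine (P A) &
      `|\int[P]_(w in A) ((X t.+1 w - X t w) ^+ 2) - s2 * fine (P A)|
         <= e / ln z * fine (P A)].
Proof.
move=> t0 cp cn c2 H z A xz FA Az.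
have mF := filtration_measurable t0; have sF := filtration_sigma t0.
have mA := mF _ FA.
have mD := measurable_increment t0.
have {}H : {ae P, forall w, A w ->
        [/\ Zp w \is a fin_num, Zn w \is a fin_num, Z2 w \is a fin_num,
            `|fine (Zp w) - fine (Zn w) - c / z| <= e / (z * ln z) &
            `|fine (Z2 w) - s2| <= e / ln z]}.
  apply: filterS H => w H Aw; have /= e1 := Az w Aw.
  by move: H; rewrite e1; apply.
have u2 : {ae P, forall w, A w -> (Z2 w <= (s2 + e / ln z)%:E)%E}.
  apply: filterS H => w H /H [_ _ f2 _]; rewrite ler_norml => /andP[_ h].
  by rewrite -[Z2 w]fineK// lee_fin; lra.
have I2 : P.-integrable A (EFin \o (fun w => (X t.+1 w - X t w) ^+ 2)).
  apply: (cexp_integrable mF _ _ c2 FA u2); last by move=> w; exact: sqr_ge0.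
  exact: measurable_funX.
have IB (f : T -> R) : measurable_fun setT f ->
    (forall w, `|f w| <= `|X t.+1 w - X t w|) -> P.-integrable A (EFin \o f).
  move=> mf fD.
  have J : P.-integrable A (EFin \o (fun w => 1 + (X t.+1 w - X t w) ^+ 2)).
    have J0 : P.-integrable A (EFin \o (fun=> 1)).
      by apply: (finite_measure_integrable_cst P 1 mA).
    by apply: eq_integrable (integrableD mA J0 I2).
  apply: le_integrable J => //.
    by apply/measurable_EFinP; apply: measurable_funS mf.
  move=> w _; rewrite /= lee_fin (le_trans (fD w))//.
  rewrite (@ger0_norm _ (1 + _)) ?addr_ge0 ?sqr_ge0//.
  rewrite -(@real_normK _ (X t.+1 w - X t w)) ?num_real//.
  by have := normr_ge0 (X t.+1 w - X t w); move: (`|_|) => v v0; nra.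
have ID := IB _ mD (fun w => lexx _).
have Ip : P.-integrable A (EFin \o (fun w => Num.max (X t.+1 w - X t w) 0)).
  apply: IB; first exact: measurable_maxr.
  by move=> w; case: (leP (X t.+1 w - X t w) 0) => // _; rewrite normr0.
have In : P.-integrable A (EFin \o (fun w => Num.max (X t w - X t.+1 w) 0)).
  apply: IB.
    apply: measurable_maxr => //.
    by apply: measurable_funB; exact: measurable_process.
  move=> w; rewrite (distrC (X t.+1 w)).
  by case: (leP (X t w - X t.+1 w) 0) => // _; rewrite normr0.
have pos (f : T -> R) w : 0 <= Num.max (f w) 0 by rewrite le_max lexx orbT.
have eD : \int[P]_(w in A) (X t.+1 w - X t w) =
    \int[P]_(w in A) Num.max (X t.+1 w - X t w) 0
    - \int[P]_(w in A) Num.max (X t w - X t.+1 w) 0.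
  rewrite -RintegralB//; apply: eq_Rintegral => w _.
  rewrite -(opprB (X t w)); move: (X t w - _) => v.
  by case: (leP v 0) => h1; case: (leP (- v) 0) => h2; lra.
split => //.
- rewrite eD ler_norml; apply/andP; split.
  + suff : \int[P]_(w in A) Num.max (X t w - X t.+1 w) 0
      - \int[P]_(w in A) Num.max (X t.+1 w - X t w) 0 <= (e / (z * ln z) - c / z) * fine (P A) by lra.
    apply: (cexp_diff_ub mF (pos _) (pos _) In Ip cn cp FA).
    apply: filterS H => w H /H [fp fn _ h _]; split => //.
    by move: h; rewrite ler_norml => /andP[h _]; lra.
  + suff : \int[P]_(w in A) Num.max (X t.+1 w - X t w) 0
      - \int[P]_(w in A) Num.max (X t w - X t.+1 w) 0 <= (e / (z * ln z) + c / z) * fine (P A) by lra.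
    apply: (cexp_diff_ub mF (pos _) (pos _) Ip In cp cn FA).
    apply: filterS H => w H /H [fp fn _ h _]; split => //.
    by move: h; rewrite ler_norml => /andP[_ h]; lra.
- have Y20 w : 0 <= (X t.+1 w - X t w) ^+ 2 by exact: sqr_ge0.
  have IZ : P.-integrable A (EFin \o (fun=> 0)) by exact: integrable0.
  have i0 : \int[P]_(w in A) 0 = 0 by rewrite Rintegral_cst// mul0r.
  rewrite ler_norml; apply/andP; split.
  + suff : \int[P]_(w in A) 0 - \int[P]_(w in A) ((X t.+1 w - X t w) ^+ 2) <= (e / ln z - s2) * fine (P A).
      by rewrite i0; lra.
    apply: (cexp_diff_ub mF (fun=> lexx 0) Y20 IZ I2 (is_cexp0 P sF) c2 FA).
    apply: filterS H => w H /H [_ _ f2 _ h]; split => //=.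
    by move: h; rewrite ler_norml => /andP[h _]; lra.
  + suff : \int[P]_(w in A) ((X t.+1 w - X t w) ^+ 2) - \int[P]_(w in A) 0 <= (e / ln z + s2) * fine (P A).
      by rewrite i0; lra.
    apply: (cexp_diff_ub mF Y20 (fun=> lexx 0) I2 IZ c2 (is_cexp0 P sF) FA).
    apply: filterS H => w H /H [_ _ f2 _ h]; split => //=.
    by move: h; rewrite ler_norml => /andP[_ h]; lra.
Qed.

End process.

Section drift_step.
Context {d : measure_display} {T : measurableType d} {R : realType}.
Variables (P : probability T R) (F : nat -> set (set T)) (X : nat -> T -> R).
Hypotheses (filtF : is_filtration F) (adX : adapted F X).

Lemma drift_step (c s2 p delta C : R) (Z : nat -> T -> \bar R) (q b th : R) :
  A2 P F X c s2 ->
  (forall t, (0 < t)%N ->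
    is_cexp P (F t) (fun w => (`|X t.+1 w - X t w| `^ p)%:E) (Z t) /\
    {ae P, forall w, (Z t w <= (C * (1 + X t w) `^ (p - 2 - delta))%:E)%E}) ->
  0 < th ->
  exists2 eta, 0 < eta & \forall z \near +oo, forall t A (h : T -> R),
    (0 < t)%N -> F t A -> A `<=` [set w | X t w = z] ->
    P.-integrable A (EFin \o h) ->
    ((forall w, A w -> taylor_xl q b z (X t.+1 w)
         - err_xl q b p delta eta z (X t.+1 w) <= h w) ->
     (xl q b z + xl (q - 2) (b - 1) z * (drift_coef s2 c q b (ln z) - th))
       * fine (P A) <= \int[P]_(w in A) h w) /\
    ((forall w, A w -> h w <= taylor_xl q b z (X t.+1 w)
         + err_xl q b p delta eta z (X t.+1 w)) ->
     \int[P]_(w in A) h w <=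
     (xl q b z + xl (q - 2) (b - 1) z * (drift_coef s2 c q b (ln z) + th))
       * fine (P A)).
Proof.
move=> [s20 [Zp [Zn [Z2 [cZ aZ]]]]] HM th0.
have [e e0 [eta eta0 Hnear]] := @near_drift R q b p delta s2 c `|C| th s20 th0.
have [x0 Hx0] := aZ e e0.
exists eta => //; near=> z.
have zx0 : x0 <= z by near: z; apply: nbhs_pinfty_ge; exact: num_real.
have z0 : 0 < z by near: z; apply: nbhs_pinfty_gt; exact: num_real.
have Hz : forall pi E1 E2 Ep : R, 0 <= pi ->
    `|E1 - c / z * pi| <= e / (z * ln z) * pi ->
    `|E2 - s2 * pi| <= e / ln z * pi ->
    Ep <= `|C| * (1 + z) `^ (p - 2 - delta) * pi ->
    `|xl1 q b z * E1 + xl2 q b z / 2 * E2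
       - pi * xl (q - 2) (b - 1) z * drift_coef s2 c q b (ln z)|
    + eta * xl q (b - 1) z * (E2 / z ^+ 2 + z `^ delta * (Ep / z `^ p))
    <= th * pi * xl (q - 2) (b - 1) z.
  by near: z; exact: Hnear.
move=> t A h t0 FA Az Ih.
have mA := filtration_measurable filtF t0 FA.
have [cp cn c2] := cZ t t0.
have [I1 I2 B1 B2] := A2_step filtF adX t0 cp cn c2 (Hx0 t t0) zx0 FA Az.
have [I3 B3] := Mp_step filtF adX HM t0 FA Az.
have pi0 : 0 <= fine (P A) by rewrite fine_ge0.
have := Hz _ _ _ _ pi0 B1 B2 B3.
pose D w := X t.+1 w - X t w.
have PI (a0 a1 a2 a3 : R) := Rintegral_poly a0 a1 a2 a3 mA I1 I2 I3.
rewrite -/(D _).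
pose a2 := eta * xl q (b - 1) z / z ^+ 2.
pose a3 := eta * xl q (b - 1) z * z `^ delta / z `^ p.
have errE w : A w -> err_xl q b p delta eta z (X t.+1 w) = a2 * D w ^+ 2 + a3 * `|D w| `^ p.
  move=> /Az /= e1; rewrite /D e1 /err_xl /a2 /a3 normrM normfV (gtr0_norm z0).
  rewrite powR_div ?(ltW z0)//; field.
  by rewrite !gt_eqF// powR_gt0.
have tayE w : A w -> taylor_xl q b z (X t.+1 w) = xl q b z + xl1 q b z * D w + xl2 q b z / 2 * D w ^+ 2.
  by move=> /Az /= e1; rewrite /D e1.
set J1 := \int[P]_(w in A) _; set J2 := \int[P]_(w in A) (_ ^+ 2);
set J3 := \int[P]_(w in A) (_ `^ p).
have -> : eta * xl q (b - 1) z * (J2 / z ^+ 2 + z `^ delta * (J3 / z `^ p)) = a2 * J2 + a3 * J3.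
  by rewrite /a2 /a3; field; rewrite !gt_eqF// powR_gt0.
move=> HH.
have := HH; rewrite -lerBrDr ler_norml => /andP[Hl Hu].
split=> Hh.
- have [I EI] := PI (xl q b z) (xl1 q b z) (xl2 q b z / 2 - a2) (- a3).
  have := @le_Rintegral _ _ _ P A _ h mA I Ih; rewrite EI => H.
  apply: le_trans (H _); first by rewrite -/J1 -/J2 -/J3; lra.
  move=> w Aw; apply: le_trans (Hh w Aw); rewrite errE// tayE// -/(D w); lra.
- have [I EI] := PI (xl q b z) (xl1 q b z) (xl2 q b z / 2 + a2) a3.
  have := @le_Rintegral _ _ _ P A h _ mA Ih I; rewrite EI => H.
  apply: le_trans (H _) _; last by rewrite -/J1 -/J2 -/J3; lra.
  move=> w Aw; apply: le_trans (Hh w Aw) _; rewrite errE// tayE// -/(D w); lra.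
Unshelve. all: by end_near. Qed.

Lemma le_Rintegral_atoms t (s : seq R) (f h : T -> R) (A : set T) : (0 < t)%N ->
  P.-integrable setT (EFin \o f) -> P.-integrable setT (EFin \o h) ->
  F t A -> (forall w, A w -> X t w \in s) ->
  (forall z A', z \in s -> F t A' -> A' `<=` A -> A' `<=` [set w | X t w = z] ->
     \int[P]_(w in A') f w <= \int[P]_(w in A') h w) ->
  \int[P]_(w in A) f w <= \int[P]_(w in A) h w.
Proof.
move=> t0 If Ih.
have sF := filtration_sigma filtF t0; have mF := filtration_measurable filtF t0.
elim: s A => [|z s IH] A FA As H.
  rewrite (_ : A = set0) ?Rintegral_set0//.
  by apply/seteqP; split => // w /As; rewrite in_nil.
pose A1 := A `&` X t @^-1` [set z]; pose A2 := A `&` ~` (X t @^-1` [set z]).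
have Fz : F t (X t @^-1` [set z]) by apply: (filtration_level adX t0).
have FA1 : F t A1 by apply: (sub_sigmaI sF).
have FA2 : F t A2 by apply: (sub_sigmaI sF) => //; exact: (sub_sigmaC sF).
have -> : A = A1 `|` A2 by rewrite /A1 /A2 -setIUr setUv setIT.
have dj : [disjoint A1 & A2].
  apply/eqP; rewrite /A1 /A2 -subset0 => w [[_ ?] [_]]; exact.
rewrite !Rintegral_setU//; try exact: mF; first last.
- apply: integrableS If => //; apply: measurableU; exact: mF.
- apply: integrableS Ih => //; apply: measurableU; exact: mF.
apply: lerD.
  by apply: (H z) => //; [rewrite mem_head|move=> w []|move=> w []].
apply: IH => //.
  by move=> w [/As + /eqP/negbTE zX]; rewrite inE zX.
move=> y A' ys FA' A'A A'y; apply: (H y) => //; first by rewrite inE ys orbT.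
by move=> w /A'A [].
Qed.

End drift_step.

(** * Tail bounds for the running maximum *)

Section stopped.
Context {d : measure_display} {T : measurableType d} {R : realType}.
Variables (P : probability T R) (F : nat -> set (set T)) (X : nat -> T -> R).
Hypotheses (filtF : is_filtration F) (adX : adapted F X).

Definition below (x : R) (t : nat) : set T :=
  [set w | forall s, (0 < s <= t)%N -> X s w < x].

Lemma belowS x t : below x t.+1 = below x t `&` [set w | X t.+1 w < x].
Proof.
apply/seteqP; split => w.
  move=> H; split; last by apply: H; rewrite ltnS leqnn.
  by move=> s /andP[s0 st]; apply: H; rewrite s0 ltnW.
move=> [H H1] s /andP[s0]; rewrite leq_eqVlt => /predU1P[->//|st].
by apply: H; rewrite s0.
Qed.

Lemma below_F x t : (0 < t)%N -> F t (below x t).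
Proof.
elim: t => // t IH _; rewrite belowS.
have sF := filtration_sigma filtF (ltn0Sn t).
apply: (sub_sigmaI sF); last first.
  have -> : [set w | X t.+1 w < x] = X t.+1 @^-1` `]-oo, x[.
    by apply/seteqP; split => w /=; rewrite in_itv.
  exact: (filtration_level adX).
case: t IH sF => [_ sF|t IH sF].
  rewrite (_ : below x 0 = setT); first exact: (sub_sigmaT sF).
  by apply/seteqP; split => // w _ s /andP[]; case: s.
apply: (@filtration_mono _ _ _ filtF t.+1) => //; exact: IH.
Qed.

Lemma measurable_below x t : (0 < t)%N -> measurable (below x t).
Proof. by move=> t0; apply: (filtration_measurable filtF t0); exact: below_F. Qed.

Lemma below_anti x s t : (s <= t)%N -> below x t `<=` below x s.
Proof. by move=> st w H k /andP[k0 ks]; apply: H; rewrite k0 (leq_trans ks). Qed.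

Variables (gM : R -> R) (M x : R).
Hypotheses (mg : measurable_fun setT gM) (g0 : forall y, 0 <= gM y)
  (gM_le : forall y, gM y <= M).

(* [gM (X t)] until [X] first reaches [x], and from then on the upper bound [M]
   of [gM] instead of the value at the exit time, so that the overshoot never
   has to be controlled. *)
Definition stop (t : nat) (w : T) : R := M + \1_(below x t) w * (gM (X t w) - M).

Lemma stop_in t w : below x t w -> stop t w = gM (X t w).
Proof. by move=> B; rewrite /stop indicE mem_set// mul1r subrKC. Qed.

Lemma stop_out t w : ~ below x t w -> stop t w = M.
Proof. by move=> B; rewrite /stop indicE memNset// mul0r addr0. Qed.

Lemma stop_ge0 t w : 0 <= stop t w.
Proof.
have [B|B] := pselect (below x t w); first by rewrite stop_in.
by rewrite stop_out// (le_trans (g0 0)).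
Qed.

Lemma stop_le t w : stop t w <= M.
Proof. by have [B|B] := pselect (below x t w); [rewrite stop_in|rewrite stop_out]. Qed.

Lemma stop_ge t w : gM (X t w) <= stop t w.
Proof. by have [B|B] := pselect (below x t w); [rewrite stop_in|rewrite stop_out]. Qed.

Lemma measurable_stop t : (0 < t)%N -> measurable_fun setT (stop t).
Proof.
move=> t0; apply: measurable_funD => //; apply: measurable_funM.
  by apply: measurable_indic; exact: measurable_below.
apply: measurable_funB => //; apply: measurableT_comp => //.
exact: (measurable_process filtF adX).
Qed.

Lemma integrable_bounded (f : T -> R) A : measurable A -> measurable_fun setT f ->
  (forall w, 0 <= f w <= M) -> P.-integrable A (EFin \o f).
Proof.
move=> mA mf f01; apply: measurable_bounded_integrable => //.
- by rewrite (le_lt_trans (probability_le1 P mA))// ltry.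
- exact: measurable_funS mf.
- exists M; split; first exact: num_real.
  move=> y My w _ /=; have /andP[h1 h2] := f01 w.
  by rewrite ger0_norm// (le_trans h2)// ltW.
Qed.

Lemma integrable_stop t A : (0 < t)%N -> measurable A ->
  P.-integrable A (EFin \o stop t).
Proof.
move=> t0 mA; apply: integrable_bounded => //; first exact: measurable_stop.
by move=> w; rewrite stop_ge0 stop_le.
Qed.

Lemma Rintegral_stop_atom t z A : (0 < t)%N -> measurable A -> A `<=` below x t ->
  A `<=` [set w | X t w = z] -> \int[P]_(w in A) stop t w = gM z * fine (P A).
Proof.
move=> t0 mA AB Az; rewrite -(Rintegral_cst P mA); apply: eq_Rintegral => w.
by rewrite inE => Aw; rewrite stop_in ?(Az _ Aw)//; exact: AB.
Qed.

Lemma stop_outS t A : A `<=` ~` below x t -> {in A, stop t.+1 =1 stop t}.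
Proof.
move=> AB w; rewrite inE => Aw; have n1 : ~ below x t w := AB w Aw.
by rewrite !stop_out// => /(below_anti (leqnSn t)).
Qed.

End stopped.

Section truncated_power_log.
Context {R : realType}.
Implicit Types (q b x y z : R).

Lemma xl_le q b x y : 0 <= q -> 1 <= ln x -> - b <= q * ln x -> x <= y ->
  xl q b x <= xl q b y.
Proof.
move=> q0 l1 bq xy.
have x1 := ln_ge1_gt1 l1.
have d u : u \in `[x, y] -> is_derive u 1 (xl q b) (xl1 q b u).
  by rewrite in_itv/= => /andP[xu _]; apply: is_derive_xl; apply: lt_le_trans xu.
have cont : {within `[x, y], continuous (xl q b)}.
  by apply: derivable_within_continuous => u /d du; exact: ex_derive.
have d' u : u \in `]x, y[ -> is_derive u 1 (xl q b) (xl1 q b u).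
  by move=> uxy; apply/d/subset_itv_oo_cc.
have [u uxy E] := MVT_segment xy d' cont.
rewrite -subr_ge0 E mulr_ge0 ?subr_ge0//.
move: uxy; rewrite in_itv/= => /andP[xu uy].
have lxu : ln x <= ln u by rewrite ler_ln ?posrE//; lra.
rewrite xl1E; last lra.
rewrite mulr_ge0 ?mulr_ge0 ?powR_ge0//; first lra.
have : q * ln x <= q * ln u by rewrite ler_wpM2l.
lra.
Qed.

Lemma measurable_xl q b : measurable_fun setT (xl q b).
Proof.
apply: measurable_funM; first exact: measurable_powR.
exact: (measurableT_comp (measurable_powR b) (@measurable_ln R)).
Qed.

Definition txl q b x1 (M : R) y := Num.min (xl q b (Num.max y x1)) M.

Lemma measurable_txl q b x1 M : measurable_fun setT (txl q b x1 M).
Proof.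
apply: measurable_minr => //; apply: (measurableT_comp (measurable_xl q b)).
exact: measurable_maxr.
Qed.

Lemma txl_ge0 q b x1 M y : 0 <= M -> 0 <= txl q b x1 M y.
Proof. by move=> M0; rewrite le_min xl_ge0. Qed.

Lemma txl_le q b x1 M y : txl q b x1 M y <= M.
Proof. by rewrite ge_min lexx orbT. Qed.

Lemma powRD_le (p x y m : R) : 0 <= p -> 0 <= m -> 0 <= x -> 0 <= y -> m <= x + y ->
  m `^ p <= 2 `^ p * x `^ p + 2 `^ p * y `^ p.
Proof.
move=> p0 m0 x0 y0 mxy.
apply: (@le_trans _ _ ((2 * Num.max x y) `^ p)).
  by apply: ler_powRl => //; apply: (le_trans mxy); case: (leP x y) => ?; lra.
rewrite powRM ?le_max ?x0// -mulrDr ler_wpM2l ?powR_ge0//.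
by case: (leP x y) => ?; rewrite ?lerDr ?lerDl powR_ge0.
Qed.

Lemma pinfty_ex (Q : R -> Prop) (a : R) : (\forall z \near +oo, Q z) ->
  exists2 x, a <= x & forall z, x <= z -> Q z.
Proof.
move=> [y [_ H]]; exists (Num.max a (y + 1)); first by rewrite le_max lexx.
by move=> z; rewrite ge_max => /andP[_ yz]; apply: H; lra.
Qed.

End truncated_power_log.

Section Rintegral_split.
Context {d : measure_display} {T : measurableType d} {R : realType}.
Variable P : probability T R.

Lemma Rintegral_split (A D : set T) (f : T -> R) : measurable A -> measurable D ->
  P.-integrable setT (EFin \o f) ->
  \int[P]_(w in A) f w = \int[P]_(w in A `&` D) f w + \int[P]_(w in A `&` ~` D) f w.
Proof.
move=> mA mD If; rewrite -Rintegral_setU.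
- by rewrite -setIUr setUv setIT.
- exact: measurableI.
- by apply: measurableI => //; exact: measurableC.
- by rewrite -setIUr setUv setIT; apply: integrableS If.
- by apply/eqP; rewrite -subset0 => w [[_ ?] [_]]; exact.
Qed.

Lemma Rintegral_cst_probability (A : set T) (k : R) : measurable A ->
  \int[P]_(w in A) k = k * fine (P A).
Proof. by move=> mA; exact: (Rintegral_cst P mA). Qed.

Lemma fine_probabilityC (A : set T) : measurable A ->
  fine (P (~` A)) = 1 - fine (P A).
Proof.
by move=> mA; rewrite probability_setC// fineB ?fin_num_probability.
Qed.

End Rintegral_split.

Lemma upper_tail (d : measure_display) (T : measurableType d) (R : realType)
  (P : probability T R) (F : nat -> set (set T)) (X : nat -> T -> R) (S : set R)
  (c s2 p delta C : R) (Z : nat -> T -> \bar R) (q b th B0 : R) :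
  A0 P F X S -> A2 P F X c s2 ->
  (forall t, (0 < t)%N ->
    is_cexp P (F t) (fun w => (`|X t.+1 w - X t w| `^ p)%:E) (Z t) /\
    {ae P, forall w, (Z t w <= (C * (1 + X t w) `^ (p - 2 - delta))%:E)%E}) ->
  2 < p -> 0 < delta -> 0 < q -> q <= p -> b <= 0 -> 0 < th ->
  (\forall z \near +oo,
     xl (q - 2) (b - 1) z * (drift_coef s2 c q b (ln z) + th) <= B0) ->
  exists B x0, [/\ 0 < B, 1 < x0 & forall x t, x0 <= x -> (0 < t)%N ->
    xl q b x * (1 - fine (P (below X x t))) <= B * t%:R].
Proof.
move=> [[S00 S0 Sfin _] [filtF adX SX X1]] HA2 HM p2 d0 q0 qp b0 th0 HB.
have [eta eta0 Hd] := drift_step filtF adX q b HA2 HM th0.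
have eta20 : 0 < eta / 2 by rewrite divr_gt0.
have [x1 x1e Hx1] := pinfty_ex 1 (near_ln_ge (Num.max 1 (- b / q))).
have Hl x : x1 <= x -> 1 <= ln x /\ - b <= q * ln x.
  by move=> /Hx1; rewrite ge_max => /andP[h1]; rewrite ler_pdivrMr// mulrC.
have xlmono x y : x1 <= x -> x <= y -> xl q b x <= xl q b y.
  by move=> /Hl [h1 h2] xy; apply: xl_le => //; exact: ltW.
have xl_pow x : x1 <= x -> xl q b x <= x `^ q.
  move=> /Hl [h1 _]; rewrite /xl ler_piMr ?powR_ge0//.
  by rewrite -[leRHS](@powRr0 _ (ln x)) ler_powR.
have Nsmall := near_taylor_xl_small q b p2 d0 eta0.
have Nlarge := near_taylor_xl_large q b p2 d0 eta20.
have Npow := near_powR_le_err b qp d0 eta20.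
have [x2 x2e H2] := pinfty_ex (2 * x1)
  (filterI Hd (filterI Nsmall (filterI Nlarge (filterI Npow HB)))).
have x2e' : x1 <= x2 by clear -x1e x2e; lra.
pose K := 2 `^ p * x2 `^ p + 2 `^ p * (`|C| * (1 + x2) `^ `|p - 2 - delta|).
have K0 : 0 <= K by rewrite addr_ge0 ?mulr_ge0 ?powR_ge0.
pose B := `|B0| + K.
have B_ge0 : 0 <= B by rewrite addr_ge0.
exists (B + xl q b x1 + 1), (x2 + 1).
have bp : 0 < B + xl q b x1 + 1 by rewrite ltr_wpDl// addr_ge0 ?xl_ge0.
split=> //; first by clear -x1e x2e'; lra.
move=> x t xx2 t0.
have xx1 : x1 <= x by clear -xx2 x2e'; lra.
pose M := xl q b x; have M0 : 0 <= M by exact: xl_ge0.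
pose g := txl q b x1 M.
have mg : measurable_fun setT g by exact: measurable_txl.
have g0 y : 0 <= g y by exact: txl_ge0.
have gle y : g y <= M by exact: txl_le.
pose U := stop X g M x.
have IU s A : (0 < s)%N -> measurable A -> P.-integrable A (EFin \o U s).
  by move=> s0 mA; exact: (integrable_stop P filtF adX).
have P1 : fine (P setT) = 1 by rewrite probability_setT.
have IUB s A : (0 < s)%N -> measurable A -> P.-integrable A (EFin \o (fun w => U s w + B)).
  move=> s0 mA; have J : P.-integrable A (EFin \o (fun=> B)).
    by apply: (finite_measure_integrable_cst P B mA).
  by apply: eq_integrable (integrableD mA (IU s A s0 mA) J).
have UB s A : (0 < s)%N -> measurable A ->
    \int[P]_(w in A) (U s w + B) = \int[P]_(w in A) U s w + B * fine (P A).
  move=> s0 mA; have J : P.-integrable A (EFin \o (fun=> B)).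
    by apply: (finite_measure_integrable_cst P B mA).
  by rewrite (RintegralD mA (IU s A s0 mA) J) Rintegral_cst.
have [sq sqE] : exists sq : seq R, [set y | S y /\ y <= x] = [set` sq].
  by apply/finite_seqP; exact: Sfin.
have atom s z A : (0 < s)%N -> z \in sq -> F s A -> A `<=` below X x s ->
    A `<=` [set w | X s w = z] ->
    \int[P]_(w in A) U s.+1 w <= \int[P]_(w in A) (U s w + B).
  move=> s0 zs FA AB Az.
  have mA := filtration_measurable filtF s0 FA.
  have pi0 : 0 <= fine (P A) by rewrite fine_ge0.
  have [->|/set0P [w0 Aw0]] := eqVneq A set0; first by rewrite !Rintegral_set0.
  have zx : z < x.
    by rewrite -(Az _ Aw0); apply: (AB _ Aw0); rewrite s0 leqnn.
  have z0 : 0 <= z by rewrite -(Az _ Aw0); apply: S0; exact: SX.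
  rewrite (UB s A s0 mA) (Rintegral_stop_atom P g M s0 mA AB Az).
  have Ug w : A w -> U s.+1 w <= xl q b (Num.max (X s.+1 w) x1).
    move=> Aw; have [Bw|Bw] := pselect (below X x s.+1 w).
      by rewrite /U stop_in// ge_min lexx.
    rewrite /U stop_out//; apply: xlmono => //.
    rewrite le_max leNgt; apply/orP; left; apply/negP => XX; apply: Bw.
    by rewrite belowS; split => //; exact: AB.
  have [zx2|x2z] := ltP z x2.
    have [I3 B3] := Mp_step filtF adX HM s0 FA Az.
    have JK : P.-integrable A (EFin \o (fun=> 2 `^ p * x2 `^ p)).
      by apply: (finite_measure_integrable_cst P _ mA).
    have J3 : P.-integrable A (EFin \o (fun w => 2 `^ p * `|X s.+1 w - X s w| `^ p)).
      by apply: eq_integrable (integrableZl mA (2 `^ p) I3).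
    have J : P.-integrable A (EFin \o (fun w => 2 `^ p * x2 `^ p + 2 `^ p * `|X s.+1 w - X s w| `^ p)).
      by apply: eq_integrable (integrableD mA JK J3).
    apply: (@le_trans _ _ (\int[P]_(w in A) (2 `^ p * x2 `^ p + 2 `^ p * `|X s.+1 w - X s w| `^ p))).
      apply: le_Rintegral => //; first exact: IU.
      move=> w Aw; apply: (le_trans (Ug w Aw)).
      set m := Num.max _ _; set D := `|_|.
      have D0 : 0 <= D by exact: normr_ge0.
      have m1 : x1 <= m by rewrite le_max lexx orbT.
      have mD : m <= x2 + D.
        rewrite ge_max; apply/andP; split; last by clear -x2e' D0; lra.
        have := ler_norm (X s.+1 w - X s w); have := Az w Aw; rewrite /= -/D.
        by clear -zx2; lra.
      have m1' : 1 <= m by clear -m1 x1e; lra.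
      apply: (le_trans (xl_pow m m1)).
      apply: (@le_trans _ _ (m `^ p)); first exact: ler_powR.
      apply: powRD_le => //; first by clear -p2; lra.
        by clear -m1'; lra.
      by clear -x2e' x1e; lra.
    rewrite (RintegralD mA JK J3) Rintegral_cst// RintegralZl//.
    apply: (@le_trans _ _ (K * fine (P A))).
      rewrite /K mulrDl; apply: lerD => //.
      rewrite -mulrA ler_wpM2l ?powR_ge0//; apply: (le_trans B3).
      rewrite ler_wpM2r// ler_wpM2l//.
      apply: (@le_trans _ _ ((1 + z) `^ `|p - 2 - delta|)).
        by apply: ler_powR; [by clear -z0; lra|exact: ler_norm].
      by apply: ler_powRl => //; clear -z0 zx2; lra.
    apply: (@le_trans _ _ (B * fine (P A))); first by rewrite ler_wpM2r// lerDr.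
    by rewrite lerDr mulr_ge0.
  have [H21 [H22 [H23 [H24 H25]]]] := H2 z x2z.
  have [_ H] := H21 s A (U s.+1) s0 FA Az (IU s.+1 A isT mA).
  apply: (@le_trans _ _ ((xl q b z + B) * fine (P A))); last first.
    rewrite mulrDl lerD2r ler_wpM2r// /g /txl.
    have -> : Num.max z x1 = z by apply/max_idPl; clear -x2e' x2z; lra.
    by rewrite le_min lexx/= xlmono//; [clear -x2e' x2z; lra|exact: ltW].
  apply: le_trans (H _) _; last first.
    by rewrite ler_wpM2r// lerD2l (le_trans H25)// (le_trans (ler_norm _))// lerDl.
  move=> w Aw; apply: (le_trans (Ug w Aw)).
  set y := X s.+1 w.
  have [yz|yz] := leP `|y - z| (z / 2).
    have := H22 y yz; move: yz; rewrite !ler_norml => /andP[y1 y2] /andP[y3 y4].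
    have -> : Num.max y x1 = y by apply/max_idPl; clear -y1 x2e x2z; lra.
    by clear -y4; lra.
  have := H23 y yz; have h4 := H24 y yz; rewrite ler_norml => /andP[h3 _].
  have e2 : err_xl q b p delta eta z y = err_xl q b p delta (eta / 2) z y + err_xl q b p delta (eta / 2) z y.
    by rewrite /err_xl -mulrDl -mulrDl -splitr.
  have h5 : xl q b (Num.max y x1) <= err_xl q b p delta (eta / 2) z y.
    apply: le_trans h4; apply: le_trans (xl_pow _ _) _; first by rewrite le_max lexx orbT.
    have y0 : 0 <= y by apply: S0; exact: SX.
    apply: ler_powRl; [exact: ltW|by rewrite le_max y0|].
    rewrite ge_max; have yy := ler_norm (y - z).
    by clear -yz yy x2e x2z z0; apply/andP; split; lra.
  by rewrite e2; clear -h3 h5; lra.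
have step s : (0 < s)%N -> \int[P]_w U s.+1 w <= \int[P]_w U s w + B.
  move=> s0; have mB := measurable_below filtF adX x s0.
  rewrite -[B in leRHS]mulr1 -P1 -UB//.
  rewrite (Rintegral_split measurableT mB (IU s.+1 setT isT measurableT)).
  rewrite (Rintegral_split measurableT mB (IUB s setT s0 measurableT)) !setTI.
  apply: lerD.
    apply: (@le_Rintegral_atoms _ _ _ P F X filtF adX s sq) => //.
    - exact: IU.
    - exact: IUB.
    - exact: below_F.
    - move=> w Bw; suff : [set` sq] (X s w) by [].
      rewrite -sqE; split; first exact: SX.
      by apply/ltW/Bw; rewrite s0 leqnn.
    - by move=> z A' zs FA' A'B A'z; apply: (atom s z A').
  apply: le_Rintegral; first exact: measurableC.
  - by apply: IU => //; exact: measurableC.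
  - by apply: IUB => //; exact: measurableC.
  - move=> w Bw; rewrite /U (stop_outS g M (@subset_refl _ (~` below X x s))) ?inE//.
    by rewrite lerDl.
have m0 : measurable [set w | X 1%N w = 0].
  rewrite (_ : [set _ | _] = X 1%N @^-1` [set 0])//.
  by apply: (filtration_measurable filtF (ltn0Sn 0)); exact: (filtration_level adX).
have init : \int[P]_w U 1%N w <= xl q b x1.
  rewrite (Rintegral_split measurableT m0 (IU 1%N setT isT measurableT)) !setTI.
  rewrite (@Rintegral_stop_atom _ _ _ P X g M x 1%N 0 _ isT m0)//; last first.
    by move=> w /= X10 [|[|s]]//; rewrite X10; clear -x1e xx1; lra.
  rewrite X1/= mulr1 -[leRHS]addr0; apply: lerD.
    rewrite /g /txl; have -> : Num.max 0 x1 = x1 by apply/max_idPr; clear -x1e; lra.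
    by rewrite ge_min lexx.
  apply: (@le_trans _ _ (\int[P]_(w in ~` [set w | X 1%N w = 0]) M)).
    apply: le_Rintegral; first exact: measurableC.
    - by apply: IU => //; exact: measurableC.
    - by apply: (finite_measure_integrable_cst P M); exact: measurableC.
    - by move=> w _; exact: stop_le.
  rewrite Rintegral_cst_probability; last exact: measurableC.
  by rewrite fine_probabilityC// X1 /= subrr mulr0.
have total : \int[P]_w U t w <= xl q b x1 + B * t%:R.
  elim: t t0 => // -[_ _|t IH _].
    by rewrite (le_trans init)// lerDl mulr_ge0.
  apply: (le_trans (step t.+1 isT)); apply: (@le_trans _ _ (xl q b x1 + B * t.+1%:R + B)).
    by rewrite lerD2r IH.
  have -> : B * t.+2%:R = B * t.+1%:R + B by rewrite -natr1 mulrDr mulr1.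
  by rewrite (addrA (xl q b x1) (B * _) B).
have mB := measurable_below filtF adX x t0.
apply: (@le_trans _ _ (\int[P]_w U t w)).
  rewrite (Rintegral_split measurableT mB (IU t setT t0 measurableT)) !setTI.
  rewrite -[leLHS]add0r; apply: lerD.
    by apply: Rintegral_ge0 => w _; exact: stop_ge0.
  rewrite [leRHS](_ : _ = \int[P]_(w in ~` below X x t) M); last first.
    by apply: eq_Rintegral => w; rewrite inE => Bw; rewrite /U stop_out.
  rewrite Rintegral_cst_probability; last exact: measurableC.
  by rewrite fine_probabilityC.
apply: (le_trans total).
have t1 : 1 <= t%:R :> R by rewrite ler1n.
have h : 0 <= xl q b x1 * (t%:R - 1) by rewrite mulr_ge0 ?subr_ge0 ?xl_ge0.
by clearbody B; clear -h t1; lra.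
Qed.

Lemma seq_pos_lb (R : realType) (s : seq R) (f : R -> R) :
  (forall z, z \in s -> 0 < f z) -> exists2 e, 0 < e & forall z, z \in s -> e <= f z.
Proof.
elim: s => [|a s IH] H; first by exists 1.
have [|e e0 He] := IH; first by move=> z zs; apply: H; rewrite inE zs orbT.
exists (Num.min e (f a)); first by rewrite lt_min e0 H// mem_head.
move=> z; rewrite inE => /predU1P[->|/He h]; first by rewrite ge_min lexx orbT.
by rewrite ge_min h.
Qed.

Lemma seq_nat_ub (R : realType) (s : seq R) (f : R -> nat) :
  exists2 e, (0 < e)%N & forall z, z \in s -> (f z <= e)%N.
Proof.
elim: s => [|a s [e e0 He]]; first by exists 1%N.
exists (maxn e (f a)); first by rewrite leq_max e0.
by move=> z; rewrite inE => /predU1P[->|/He h]; rewrite leq_max ?leqnn ?h ?orbT.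
Qed.

Lemma cexp_lb_eq (d : measure_display) (T : measurableType d) (R : realType)
  (P : probability T R) (G : set (set T)) (Y : T -> \bar R) (Y' : T -> R)
  (Z : T -> \bar R) (A : set T) (k : R) :
  G `<=` measurable -> is_cexp P G Y Z -> G A -> 0 <= k ->
  P.-integrable A (EFin \o Y') -> {in A, Y =1 EFin \o Y'} ->
  {ae P, forall w, A w -> (k%:E <= Z w)%E} ->
  k * fine (P A) <= \int[P]_(w in A) Y' w.
Proof.
move=> GM [GZ Z0 YZ] GA k0 I' YY H; have mA := GM _ GA.
have mZ : measurable_fun A Z by apply: (G_meas_measurable_fun GM).
have : (\int[P]_(w in A) cst k%:E w <= \int[P]_(w in A) Z w)%E.
  by apply: ae_ge0_le_integral => //; move=> w _; rewrite lee_fin.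
rewrite -YZ// (eq_integral _ _ YY) integral_cst_fine//.
by rewrite /Rintegral -(fineK (integrable_fin_num mA I')) lee_fin.
Qed.

Lemma lower_tail (d : measure_display) (T : measurableType d) (R : realType)
  (P : probability T R) (F : nat -> set (set T)) (X : nat -> T -> R) (S : set R)
  (c s2 p delta C : R) (Z : nat -> T -> \bar R) (q b th d0 : R) :
  A0 P F X S -> A1 P F X S -> A2 P F X c s2 ->
  (forall t, (0 < t)%N ->
    is_cexp P (F t) (fun w => (`|X t.+1 w - X t w| `^ p)%:E) (Z t) /\
    {ae P, forall w, (Z t w <= (C * (1 + X t w) `^ (p - 2 - delta))%:E)%E}) ->
  2 < p -> 0 < delta -> 0 < q -> 0 <= b -> 0 < th -> 0 < d0 ->
  (\forall z \near +oo,
     d0 <= xl (q - 2) (b - 1) z * (drift_coef s2 c q b (ln z) - th)) ->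
  exists K x0, [/\ 0 < K, 1 < x0 & forall x t, x0 <= x -> (0 < t)%N ->
    fine (P (below X x t)) * t%:R <= K * xl q b (2 * x)].
Proof.
move=> [[S00 S0 Sfin Sunb] [filtF adX SX X1]] [m [phi [mphi HA1]]] HA2 HM p2 de0 q0 b0 th0 d00 HB.
have [eta eta0 Hd] := drift_step filtF adX q b HA2 HM th0.
have [x1 x1e Hx1] := pinfty_ex 1 (@near_ln_ge R 1).
have xlmono x y : x1 <= x -> x <= y -> xl q b x <= xl q b y.
  move=> x1x xy; apply: xl_le; [exact: ltW|exact: Hx1| |exact: xy].
  apply: (@le_trans _ _ 0); first by rewrite oppr_le0.
  by rewrite mulr_ge0 ?(ltW q0)// (le_trans ler01)// Hx1.
have Nsmall := near_taylor_xl_small q b p2 de0 eta0.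
have Nlarge := near_taylor_xl_large q b p2 de0 eta0.
have [x2 x2e H2] := pinfty_ex (2 * x1)
  (filterI Hd (filterI Nsmall (filterI Nlarge HB))).
have x2e' : x1 <= x2 by clear -x1e x2e; lra.
pose a1 := xl q b x2.
have a10 : 0 < a1 by apply: xl_gt0; clear -x1e x2e; lra.
have [y [Sy yx2 ya]] : exists y, [/\ S y, x2 < y & a1 + 1 <= xl q b y].
  have [x3 x3e H3] := pinfty_ex x2 (near_mul_ln_powR_le (a1 + 1) 0 q0).
  have [y [Sy x3y]] := Sunb x3; exists y; split => //; first exact: le_lt_trans x3y.
  have := H3 y (ltW x3y); rewrite powRr0 mulr1 => /le_trans; apply.
  rewrite /xl ler_peMr ?powR_ge0// -[leLHS](@powRr0 _ (ln y)) ler_powR// Hx1//.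
  by clear -x2e' x3e x3y; lra.
have [s1 s1E] : exists s1 : seq R, [set z | S z /\ z <= x2] = [set` s1].
  by apply/finite_seqP; exact: Sfin.
have s1S z : z \in s1 -> S z.
  by move=> zs; have : [set` s1] z by []; rewrite -s1E => -[].
have [ph ph0 Hph] := @seq_pos_lb R s1 (fun z => phi z y) (fun z zs => (mphi z y (s1S z zs) Sy).2).
have [ms ms0 Hms] := @seq_nat_ub R s1 (fun z => m z y).
pose d1 := Num.min d0 ph.
have d10 : 0 < d1 by rewrite lt_min d00.
exists (ms%:R * (d1^-1 + a1^-1)), (y + 1); split.
- by rewrite mulr_gt0 ?ltr0n// addr_gt0 ?invr_gt0.
- by clear -x1e x2e' yx2; lra.
move=> x t yx t0.
have xx2 : x2 <= x by clear -yx yx2; lra.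
have x2x : x2 <= 2 * x by clear -xx2 x2e' x1e; lra.
pose M := xl q b (2 * x).
have aM : a1 <= M by exact: xlmono.
have M0 : 0 <= M by exact: xl_ge0.
pose g := txl q b x2 M.
have mg : measurable_fun setT g by exact: measurable_txl.
have g0 z : 0 <= g z by exact: txl_ge0.
have gle z : g z <= M by exact: txl_le.
have ga z : a1 <= g z.
  by rewrite le_min aM andbT; apply: xlmono => //; rewrite le_max lexx orbT.
pose U := stop X g M x.
have IU s A : (0 < s)%N -> measurable A -> P.-integrable A (EFin \o U s).
  by move=> s0 mA; exact: (integrable_stop P filtF adX).
have IC k A : measurable A -> P.-integrable A (EFin \o (fun=> k)).
  by move=> mA; exact: (finite_measure_integrable_cst P k mA).
have IUB s A : (0 < s)%N -> measurable A -> P.-integrable A (EFin \o (fun w => U s w + d1)).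
  by move=> s0 mA; apply: eq_integrable (integrableD mA (IU s A s0 mA) (IC d1 A mA)).
have UB s A : (0 < s)%N -> measurable A ->
    \int[P]_(w in A) (U s w + d1) = \int[P]_(w in A) U s w + d1 * fine (P A).
  by move=> s0 mA; rewrite (RintegralD mA (IU s A s0 mA) (IC d1 A mA)) Rintegral_cst_probability.
have [sq sqE] : exists sq : seq R, [set z | S z /\ z <= x] = [set` sq].
  by apply/finite_seqP; exact: Sfin.
have below_sq s w : (0 < s)%N -> below X x s w -> X s w \in sq.
  move=> s0 Bw; suff : [set` sq] (X s w) by [].
  rewrite -sqE; split; first exact: SX.
  by apply/ltW/Bw; rewrite s0 leqnn.
have atom_lo s k z A : (0 < s)%N -> F s A -> z < x2 -> A `<=` below X x s ->
    A `<=` [set w | X s w = z] -> \int[P]_(w in A) U s w <= \int[P]_(w in A) U (s + k)%N w.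
  move=> s0 FA zx2 AB Az; have mA := filtration_measurable filtF s0 FA.
  apply: le_Rintegral => //; first exact: IU.
    by apply: IU => //; rewrite addn_gt0 s0.
  move=> w Aw; apply: le_trans (stop_ge X x gle _ _); apply: le_trans (ga _).
  rewrite /U stop_in; last exact: AB.
  have -> : X s w = z by exact: Az.
  have e2 : Num.max z x2 = x2 by apply/max_idPr/ltW.
  by rewrite /g /txl e2 ge_min lexx.
have atom_hi s z A : (0 < s)%N -> F s A -> x2 <= z -> A `<=` below X x s ->
    A `<=` [set w | X s w = z] ->
    \int[P]_(w in A) U s w + d0 * fine (P A) <= \int[P]_(w in A) U s.+1 w.
  move=> s0 FA x2z AB Az; have mA := filtration_measurable filtF s0 FA.
  have pi0 : 0 <= fine (P A) by rewrite fine_ge0.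
  have [A00|/set0P [w0 Aw0]] := eqVneq A set0.
    by rewrite A00 !Rintegral_set0 measure0 /= mulr0 addr0.
  have zx : z < x.
    by rewrite -(Az _ Aw0); apply: (AB _ Aw0); rewrite s0 leqnn.
  have [H21 [H22 [H23 H24]]] := H2 z x2z.
  have [H _] := H21 s A (U s.+1) s0 FA Az (IU s.+1 A isT mA).
  rewrite (Rintegral_stop_atom P g M s0 mA AB Az) -mulrDl.
  apply: le_trans (H _).
    rewrite ler_wpM2r//; apply: lerD => //.
    have e2 : Num.max z x2 = z by exact/max_idPl.
    by rewrite /g /txl e2 ge_min lexx.
  move=> w Aw; apply: le_trans (stop_ge X x gle _ _).
  set u := X s.+1 w.
  have [uz|uz] := leP `|u - z| (z / 2).
    have := H22 u uz; move: uz; rewrite !ler_norml => /andP[y1 y2] /andP[y3 y4].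
    apply: (@le_trans _ _ (xl q b u)); first by clear -y3; lra.
    rewrite le_min; apply/andP; split.
      apply: xlmono; first by clear -y1 x2e x2z; lra.
      by rewrite le_max lexx.
    by apply: xlmono; [clear -y1 x2e x2z; lra|clear -y2 zx x2z x2e x1e; lra].
  apply: le_trans (g0 _); have := H23 u uz; rewrite ler_norml => /andP[_ h].
  by clear -h; lra.
have split_le s A (f h : T -> R) : (0 < s)%N -> F s A ->
    P.-integrable setT (EFin \o f) -> P.-integrable setT (EFin \o h) ->
    (forall z A', z \in sq -> F s A' -> A' `<=` below X x s ->
      A' `<=` [set w | X s w = z] ->
      \int[P]_(w in A') f w <= \int[P]_(w in A') h w) ->
    \int[P]_(w in A `&` below X x s) f w <= \int[P]_(w in A `&` below X x s) h w.
  move=> s0 FA If Ih H; apply: (@le_Rintegral_atoms _ _ _ P F X filtF adX s sq) => //.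
  - apply: (sub_sigmaI (filtration_sigma filtF s0)) => //; exact: below_F.
  - by move=> w [_ Bw]; exact: below_sq.
  - by move=> z A' zs FA' A'B A'z; apply: (H z) => // w /A'B [].
have mono1 s A : (0 < s)%N -> F s A -> \int[P]_(w in A) U s w <= \int[P]_(w in A) U s.+1 w.
  move=> s0 FA; have mB := measurable_below filtF adX x s0.
  have mA := filtration_measurable filtF s0 FA.
  rewrite (Rintegral_split mA mB (IU s setT s0 measurableT)).
  rewrite (Rintegral_split mA mB (IU s.+1 setT isT measurableT)).
  apply: lerD.
    apply: (split_le s A (U s) (U s.+1) s0 FA (IU s setT s0 measurableT)
      (IU s.+1 setT isT measurableT)).
    move=> z A' zs FA' A'B A'z; have [zx2|x2z] := ltP z x2.
      by have := atom_lo s 1%N z A' s0 FA' zx2 A'B A'z; rewrite addn1.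
    apply: le_trans (atom_hi s z A' s0 FA' x2z A'B A'z); rewrite lerDl.
    by rewrite mulr_ge0 ?(ltW d00)// fine_ge0.
  have eU : {in A `&` ~` below X x s, U s =1 U s.+1}.
    by move=> w Aw; rewrite /U (stop_outS g M (@subIsetr _ A (~` below X x s)) Aw).
  by rewrite (eq_Rintegral P eU).
have mono s k A : (0 < s)%N -> F s A -> \int[P]_(w in A) U s w <= \int[P]_(w in A) U (s + k)%N w.
  move=> s0 FA; elim: k => [|k IH]; first by rewrite addn0.
  apply: (le_trans IH); rewrite addnS; apply: mono1; first by rewrite addn_gt0 s0.
  by apply: (filtration_mono filtF s0 (leq_addr _ _)).
have atom s z A : (0 < s)%N -> z \in sq -> F s A -> A `<=` below X x s ->
    A `<=` [set w | X s w = z] ->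
    \int[P]_(w in A) (U s w + d1) <= \int[P]_(w in A) U (s + ms)%N w.
  move=> s0 zs FA AB Az; have mA := filtration_measurable filtF s0 FA.
  have pi0 : 0 <= fine (P A) by rewrite fine_ge0.
  rewrite UB//; have [zx2|x2z] := ltP z x2; last first.
    apply: (@le_trans _ _ (\int[P]_(w in A) U s.+1 w)).
      apply: le_trans (atom_hi s z A s0 FA x2z AB Az).
      by rewrite lerD2l ler_wpM2r// ge_min lexx.
    rewrite -(subnKC ms0) addnA addn1; apply: mono => //.
    exact: (filtration_mono filtF s0 (leqnSn _)).
  have [Sz zx] : S z /\ z <= x.
    by have : [set` sq] z by []; rewrite -sqE.
  have zs1 : z \in s1 by suff : [set` s1] z by []; rewrite -s1E; split=> //; exact: ltW.
  have smz : (0 < s + m z y)%N by rewrite addn_gt0 s0.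
  apply: (@le_trans _ _ (\int[P]_(w in A) U (s + m z y)%N w)); last first.
    rewrite -(subnKC (Hms z zs1)) addnA; apply: mono => //.
    exact: (filtration_mono filtF s0 (leq_addr _ _)).
  have [Zy [cZy bZy]] := HA1 y Sy s s0.
  pose Y' w : R := (X (s + m z y)%N w == y)%:R.
  have mY' : measurable_fun setT Y'.
    rewrite (_ : Y' = \1_(X (s + m z y)%N @^-1` [set y])).
      apply: measurable_indic; apply: (filtration_measurable filtF smz).
      exact: (filtration_level adX).
    apply/funext => w; rewrite indicE /Y'; congr (_%:R); congr nat_of_bool.
    by apply/eqP/idP => [h|]; [rewrite inE|rewrite inE].
  have IY : P.-integrable A (EFin \o Y').
    apply: (@integrable_bounded _ _ _ P 1 Y' A mA mY').
    by move=> w; rewrite /Y'; case: (_ == _); rewrite ?ler01 ?lexx.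
  (* On [A] the random delay [m (X s w) y] of (A1) is the constant [m z y]. *)
  have lbY : ph * fine (P A) <= \int[P]_(w in A) Y' w.
    apply: (cexp_lb_eq (filtration_measurable filtF s0) cZy FA (ltW ph0) IY).
      by move=> w; rewrite inE => /Az /= ->.
    apply: filterS bZy => w h Aw; apply: le_trans h.
    by have /= -> := Az w Aw; rewrite lee_fin Hph.
  rewrite (Rintegral_stop_atom P g M s0 mA AB Az).
  have -> : g z = a1.
    rewrite /g /txl; have -> : Num.max z x2 = x2 by apply/max_idPr/ltW.
    exact/min_idPl.
  have JJ : P.-integrable A (EFin \o (fun w => a1 + Y' w)).
    by apply: eq_integrable (integrableD mA (IC a1 A mA) IY).
  apply: (@le_trans _ _ (\int[P]_(w in A) (a1 + Y' w))).
    rewrite (RintegralD mA (IC a1 A mA) IY) Rintegral_cst_probability// lerD2l.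
    by apply: le_trans lbY; rewrite ler_wpM2r// ge_min lexx orbT.
  apply: le_Rintegral => //; first exact: IU.
  move=> w Aw; apply: le_trans (stop_ge X x gle _ _); rewrite /Y'.
  have [->|_] := eqVneq (X (s + m z y)%N w) y; last by rewrite addr0.
  rewrite le_min; apply/andP; split.
    by have -> : Num.max y x2 = y by apply/max_idPl/ltW.
  apply: (le_trans ya); apply: xlmono; first by clear -yx2 x2e'; lra.
  by clear -yx xx2 x2e' x1e; lra.
have step s : (0 < s)%N ->
    \int[P]_w U s w + d1 * fine (P (below X x s)) <= \int[P]_w U (s + ms)%N w.
  move=> s0; have mB := measurable_below filtF adX x s0.
  have FT : F s setT := sub_sigmaT (filtration_sigma filtF s0).
  have sms : (0 < s + ms)%N by rewrite addn_gt0 s0.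
  rewrite (Rintegral_split measurableT mB (IU s setT s0 measurableT)).
  rewrite (Rintegral_split measurableT mB (IU (s + ms)%N setT sms measurableT)).
  rewrite addrAC; apply: lerD.
    rewrite -{2}(setTI (below X x s)) -UB//; last exact: measurableI.
    apply: (split_le s setT (fun w => U s w + d1) (U (s + ms)%N) s0 FT
      (IUB s setT s0 measurableT) (IU (s + ms)%N setT sms measurableT)).
    by move=> z A'; exact: atom.
  apply: mono => //; apply: (sub_sigmaI (filtration_sigma filtF s0)) => //.
  by apply: (sub_sigmaC (filtration_sigma filtF s0)); exact: below_F.
have PB_mono s s' : (0 < s)%N -> (s <= s')%N ->
    fine (P (below X x s')) <= fine (P (below X x s)).
  move=> s0 ss'; have s'0 := leq_trans s0 ss'.
  have mB := measurable_below filtF adX x s0.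
  have mB' := measurable_below filtF adX x s'0.
  rewrite fine_le ?fin_num_probability//.
  by apply: le_measure; rewrite ?inE//; exact: below_anti.
have iter n j : (j <= n)%N ->
    j%:R * (d1 * fine (P (below X x (1 + n * ms)))) <= \int[P]_w U (1 + j * ms)%N w.
  elim: j => [_|j IH jn].
    by rewrite mul0r; apply: Rintegral_ge0 => w _; exact: stop_ge0.
  rewrite mulSn (addnC ms) addnA; apply: le_trans (step _ _) => //.
  rewrite -natr1 mulrDl mul1r; apply: lerD; first by apply: IH; exact: ltnW.
  rewrite ler_wpM2l ?(ltW d10)// PB_mono//.
  by rewrite leq_add2l leq_mul2r ltnW ?orbT.
pose n := (t.-1 %/ ms)%N.
have nt : (1 + n * ms <= t)%N.
  by rewrite -(prednK t0) add1n ltnS leq_trunc_div.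
have tn : (t <= n.+1 * ms)%N by rewrite -(prednK t0) ltn_ceil.
have Pt := PB_mono _ _ (isT : (0 < 1 + n * ms)%N) nt.
have IM : \int[P]_w U (1 + n * ms)%N w <= M.
  apply: (@le_trans _ _ (\int[P]_(w in setT) M)).
    apply: le_Rintegral => //; [exact: IU|exact: IC|].
    by move=> w _; exact: stop_le.
  by rewrite Rintegral_cst_probability// probability_setT mulr1.
have := iter n n (leqnn n); set Q := fine (P (below X x (1 + n * ms))) in Pt *.
have mBn := measurable_below filtF adX x (isT : (0 < 1 + n * ms)%N).
have Q1 : Q <= 1.
  by rewrite -lee_fin fineK ?fin_num_probability//; exact: probability_le1.
have Q0 : 0 <= Q by rewrite fine_ge0.
move=> /le_trans /(_ IM) nQ.
have tR : t%:R <= (n%:R + 1) * ms%:R :> R by rewrite natr1 -natrM ler_nat.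
apply: (@le_trans _ _ (Q * ((n%:R + 1) * ms%:R))).
  by apply: ler_pM => //; rewrite ?fine_ge0.
rewrite [leLHS](_ : _ = ms%:R * (n%:R * Q + Q)); last by ring.
rewrite -mulrA ler_wpM2l// mulrDl; apply: lerD.
  by rewrite [leRHS]mulrC ler_pdivlMr// -/M -mulrA (mulrC Q).
by rewrite (le_trans Q1)// [leRHS]mulrC ler_pdivlMr// mul1r.
Qed.

(** * Almost sure bounds *)

Section borel_cantelli_log.
Context {R : realType}.

Lemma powR_telescope (a : R) (k : nat) : 1 < a -> (0 < k)%N ->
  (a - 1) * k.+1%:R `^ (- a) <= k%:R `^ (1 - a) - k.+1%:R `^ (1 - a).
Proof.
move=> a1 k0; have k0' : 0 < k%:R :> R by rewrite ltr0n.
have kk : k%:R <= k.+1%:R :> R by rewrite ler_nat.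
have d (u : R) : u \in `[k%:R, k.+1%:R] ->
    is_derive u 1 ((@powR R)^~ (1 - a)) ((1 - a) * u `^ (1 - a - 1)).
  by rewrite in_itv/= => /andP[ku _]; apply: is_derive1_powR; apply: lt_le_trans ku.
have d' (u : R) : u \in `]k%:R, k.+1%:R[ ->
    is_derive u 1 ((@powR R)^~ (1 - a)) ((1 - a) * u `^ (1 - a - 1)).
  by move=> ui; apply/d/subset_itv_oo_cc.
have cont : {within `[k%:R, k.+1%:R], continuous ((@powR R)^~ (1 - a))}.
  by apply: derivable_within_continuous => u /d du; exact: ex_derive.
have [u uk E] := MVT_segment kk d' cont.
have : k.+1%:R `^ (1 - a) - k%:R `^ (1 - a) = (1 - a) * u `^ (- a).
  have e1 : k.+1%:R - k%:R = 1 :> R by rewrite -natr1 addrAC subrr add0r.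
  by move: E => /= ->; rewrite e1 mulr1; congr (_ * _ `^ _); ring.
move: uk; rewrite in_itv/= => /andP[ku uk] E'.
have u0 : 0 < u := lt_le_trans k0' ku.
have : k.+1%:R `^ (- a) <= u `^ (- a).
  rewrite !powRN lef_pV2 ?posrE ?powR_gt0//.
  by apply: ler_powRl => //; [lra|exact: ltW].
move=> h; have : (a - 1) * k.+1%:R `^ (- a) <= (a - 1) * u `^ (- a).
  by rewrite ler_wpM2l//; lra.
lra.
Qed.

Lemma sum_powR_bounded (a : R) n : 1 < a ->
  \sum_(0 <= k < n) k.+1%:R `^ (- a) <= 1 + (a - 1)^-1.
Proof.
move=> a1; have a0 : 0 < a - 1 by lra.
suff H : \sum_(0 <= k < n.+1) k.+1%:R `^ (- a) <= 1 + (a - 1)^-1 * (1 - n.+1%:R `^ (1 - a)).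
  apply: (@le_trans _ _ (\sum_(0 <= k < n.+1) k.+1%:R `^ (- a))).
    by rewrite big_nat_recr//= lerDl powR_ge0.
  apply: (le_trans H); rewrite lerD2l; apply: ler_piMr.
    by rewrite invr_ge0 ltW.
  by rewrite lerBlDr lerDl powR_ge0.
elim: n => [|n IH].
  by rewrite big_nat1 !powR1 subrr mulr0 addr0.
rewrite big_nat_recr//=; apply: (le_trans (lerD IH (lexx _))).
rewrite -addrA lerD2l -lerBrDl -mulrBr.
have := powR_telescope a1 (ltn0Sn n); rewrite -ler_pdivlMl// => h.
by apply: (le_trans h); rewrite ler_wpM2l ?invr_ge0 ?(ltW a0)//; lra.
Qed.

Lemma ln_pow2 (k : nat) : ln ((2 ^ k)%:R : R) = k%:R * ln 2.
Proof. by rewrite natrX lnXn// mulr_natl. Qed.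

Lemma borel_cantelli_log (d : measure_display) (T : measurableType d)
  (P : probability T R) (E : nat -> set T) (C a : R) :
  (forall k, (0 < k)%N -> measurable (E k)) -> 1 < a ->
  (\forall z \near +oo, forall k, z = (2 ^ k)%:R :> R ->
     fine (P (E k)) <= C * ln z `^ (- a)) ->
  {ae P, forall w, exists n, forall k, (n <= k)%N -> ~ E k w}.
Proof.
move=> mE a1 /(pinfty_ex 0) [x0 x00 H].
have ln20 : 0 < ln 2 :> R by rewrite ln_gt0// ltr1n.
pose k0 := (Num.truncn x0).+1.
have k0x k : (k0 <= k)%N -> x0 <= (2 ^ k)%:R :> R.
  move=> kk; apply: (@le_trans _ _ k0%:R).
    by rewrite ltW// /k0; have /andP[] := truncn_itv x00.
  by rewrite ler_nat (leq_trans kk)// ltnW// ltn_expl.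
pose C' := `|C| * (ln 2) `^ (- a).
have C'0 : 0 <= C' by rewrite mulr_ge0 ?powR_ge0.
pose E' k := E (k + k0)%N.
have mE' k : measurable (E' k) by apply: mE; rewrite addn_gt0 orbT.
have bE' k : fine (P (E' k)) <= C' * k.+1%:R `^ (- a).
  have := H _ (k0x (k + k0)%N (leq_addl _ _)) _ erefl; rewrite -/(E' k) ln_pow2.
  move=> /le_trans; apply.
  apply: (@le_trans _ _ (`|C| * ((k + k0)%:R * ln 2) `^ (- a))).
    by rewrite ler_wpM2r ?powR_ge0// ler_norm.
  rewrite /C' -mulrA ler_wpM2l// powRM// ?(ltW ln20)// mulrC ler_wpM2l ?powR_ge0//.
  rewrite !powRN lef_pV2 ?posrE ?powR_gt0 ?ltr0n ?addn_gt0 ?orbT//.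
  by apply: ler_powRl => //; [lra|rewrite ler_nat /k0 addnS ltnS leq_addr].
have P0 : P (lim_sup_set E') = 0.
  apply: (lim_sup_set_cvg0 mE').
  apply: (@le_lt_trans _ _ (C' * (1 + (a - 1)^-1))%:E); last exact: ltry.
  apply: lime_le; first by apply: is_cvg_nneseries => k _ _.
  near=> n; apply: (@le_trans _ _ (\sum_(0 <= k < n) (C' * k.+1%:R `^ (- a))%:E)%E).
    apply: lee_sum => k _; rewrite -[leLHS]fineK; first by rewrite lee_fin bE'.
    by rewrite fin_num_measure.
  by rewrite sumEFin lee_fin -mulr_sumr ler_wpM2l// sum_powR_bounded.
exists (lim_sup_set E'); split => //.
  by apply: bigcap_measurable => // k _; apply: bigcup_measurable.
move=> w /= nw n _; apply: contrapT => nE; apply: nw.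
exists (n + k0)%N => k nk Ek; apply: nE.
have k0k : (k0 <= k)%N := leq_trans (leq_addl n k0) nk.
exists (k - k0)%N => /=; last by rewrite /E' subnK.
by rewrite leq_subRL// addnC.
Unshelve. all: by end_near. Qed.

End borel_cantelli_log.

Section running_maximum.
Context {d : measure_display} {T : measurableType d} {R : realType}.
Implicit Type X : nat -> T -> R.

Lemma runmax_le X t w (x : R) : 0 <= x ->
  (forall s, (0 < s <= t)%N -> X s w <= x) -> runmax X t w <= x.
Proof.
move=> x0 H; rewrite /runmax big_seq; elim/big_ind: _ => //.
  by move=> y z yx zx; rewrite ge_max yx.
by move=> s; rewrite mem_index_iota ltnS => st; exact: H.
Qed.

Lemma le_runmax X t s w : (0 < s <= t)%N -> X s w <= runmax X t w.
Proof.
by move=> st; apply: le_bigmax_seq => //; rewrite mem_index_iota ltnS.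
Qed.

Lemma below_runmax X t s w (x : R) : 0 <= x -> below X x t w -> (s <= t)%N ->
  runmax X s w <= x.
Proof.
move=> x0 B st; apply: runmax_le => // u /andP[u0 us].
by apply/ltW/B; rewrite u0 (leq_trans us).
Qed.

Lemma not_below_runmax X t s w (x : R) : ~ below X x t w -> (t <= s)%N ->
  x <= runmax X s w.
Proof.
move=> B ts; rewrite leNgt; apply/negP => h; apply: B => u /andP[u0 ut].
by apply: le_lt_trans h; apply: le_runmax; rewrite u0 (leq_trans ut).
Qed.

End running_maximum.

Section almost_sure_bounds.
Context {d : measure_display} {T : measurableType d} {R : realType}.
Variables (P : probability T R) (F : nat -> set (set T)) (X : nat -> T -> R).
Hypotheses (filtF : is_filtration F) (adX : adapted F X).

Lemma near_nat (Q : R -> Prop) : (\forall z \near +oo, Q z) ->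
  exists n, forall t, (n <= t)%N -> Q t%:R.
Proof.
move=> /(pinfty_ex 0) [x x0 H]; exists (Num.truncn x).+1 => t xt; apply: H.
have /andP[_ h] := truncn_itv x0.
by rewrite ltW// (lt_le_trans h)// ler_nat.
Qed.

Lemma xl_powR (a g q z : R) : 1 < z -> xl a g z `^ q = z `^ (a * q) * ln z `^ (g * q).
Proof. by move=> z1; rewrite /xl powRM ?powR_ge0// -!powRrM. Qed.

Lemma near_ln_xl_le (a g : R) :
  \forall z \near +oo, ln (2 * xl a g z) <= (a + 2) * ln z.
Proof.
near=> z.
have l1 : 1 <= ln z by near: z; exact: near_ln_ge.
have z2 : 2 <= z by near: z; apply: nbhs_pinfty_ge; exact: num_real.
have z1 : 1 < z by lra.
have z0 : 0 < z by lra.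
have lg : 1 * ln z `^ g <= z `^ 1 by near: z; exact: near_mul_ln_powR_le.
rewrite -ln_powR ler_ln ?posrE ?powR_gt0 ?mulr_gt0 ?powR_gt0 ?ln_gt0//.
rewrite /xl powRD_gt0// (_ : 2 = 1 + 1 :> R)// powRD_gt0// mulrCA ler_wpM2l ?powR_ge0//.
move: lg; rewrite mul1r => lg; apply: ler_pM; rewrite ?powR_ge0//.
by rewrite powRr1 ?(ltW z0).
Unshelve. all: by end_near. Qed.

Lemma near_xl_ge (a g x0 : R) : 0 < a -> \forall z \near +oo, x0 <= xl a g z.
Proof.
move=> a0; near=> z.
have l1 : 1 <= ln z by near: z; exact: near_ln_ge.
have l0 : 0 < ln z by lra.
have h : x0 * ln z `^ (- g) <= z `^ a by near: z; exact: near_mul_ln_powR_le.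
by move: h; rewrite powRN ler_pdivrMr ?powR_gt0.
Unshelve. all: by end_near. Qed.

Lemma near_mul_ln_le (C g g' : R) : 0 <= C -> g < g' ->
  \forall z \near +oo, C * ln z `^ g <= ln z `^ g'.
Proof.
move=> C0 gg'; near=> z.
have l1 : 1 <= ln z by near: z; exact: near_ln_ge.
have l0 : 0 < ln z by lra.
have lc : C `^ (g' - g)^-1 <= ln z by near: z; exact: near_ln_ge.
have -> : ln z `^ g' = ln z `^ (g' - g) * ln z `^ g.
  by rewrite -powRD_gt0// subrK.
rewrite ler_wpM2r ?powR_ge0//.
rewrite [leLHS](_ : _ = (C `^ (g' - g)^-1) `^ (g' - g)); last first.
  by rewrite -powRrM mulVf ?powRr1// subr_eq0 gt_eqF.
by apply: ler_powRl; rewrite ?powR_ge0//; lra.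
Unshelve. all: by end_near. Qed.

Lemma as_upper (q g : R) : 0 < q -> 2 < g * q ->
  (exists B x0, [/\ 0 < B, 1 < x0 & forall x t, x0 <= x -> (0 < t)%N ->
    xl q (-1) x * (1 - fine (P (below X x t))) <= B * t%:R]) ->
  forall g', g < g' ->
  {ae P, forall w, exists t0 : nat, forall t, (t0 <= t)%N ->
     runmax X t w <= t%:R `^ q^-1 * ln t%:R `^ g'}.
Proof.
move=> q0 gq [B [x0 [B0 x01 H]]] g' gg'.
have qi0 : 0 < q^-1 by rewrite invr_gt0.
have g0 : 0 < g by rewrite -(pmulr_lgt0 _ q0); lra.
pose E k := ~` below X (xl q^-1 g (2 ^ k)%:R) (2 ^ k).
have p20 k : (0 < 2 ^ k)%N by rewrite expn_gt0.
have BC : {ae P, forall w, exists n, forall k, (n <= k)%N -> ~ E k w}.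
  apply: (@borel_cantelli_log R d T P E (B * (q^-1 + 2)) (g * q - 1)).
  - by move=> k _; apply: measurableC; exact: (measurable_below filtF adX).
  - lra.
  - near=> z => k zE.
    have l1 : 1 <= ln z by near: z; exact: near_ln_ge.
    have l0 : 0 < ln z by lra.
    have z1 := ln_ge1_gt1 l1; have z0 : 0 < z by lra.
    have hx : x0 <= xl q^-1 g z by near: z; exact: near_xl_ge.
    have hl : ln (2 * xl q^-1 g z) <= (q^-1 + 2) * ln z by near: z; exact: near_ln_xl_le.
    set x := xl q^-1 g z in hx hl *.
    have x1 : 1 < x by lra.
    have lx0 : 0 < ln x by rewrite ln_gt0.
    have lx : ln x <= (q^-1 + 2) * ln z.
      apply: le_trans hl; have xp : 0 < x by lra.
      have x2p : 0 < 2 * x by lra.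
      have x2x : x <= 2 * x by lra.
      by rewrite ler_ln.
    have := H x (2 ^ k)%N hx (p20 k).
    rewrite /E -zE -/x fine_probabilityC; last exact: (measurable_below filtF adX).
    set Q := 1 - _.
    have -> : xl q (-1) x = z * ln z `^ (g * q) / ln x.
      rewrite /xl powR_inv1 ?(ltW lx0)//; congr (_ / _).
      by rewrite xl_powR// mulVf ?gt_eqF// powRr1// ltW.
    have lg0 : 0 < ln z `^ (g * q) by exact: powR_gt0.
    rewrite (_ : z * ln z `^ (g * q) / ln x * Q = (ln z `^ (g * q) / ln x * Q) * z); last by ring.
    rewrite ler_pM2r// -ler_pdivlMl ?divr_gt0// => /le_trans; apply.
    rewrite invf_div opprB powRB_gt0// powRr1 ?(ltW l0)//.
    rewrite [leRHS](_ : _ = ((q^-1 + 2) * ln z / ln z `^ (g * q)) * B); last by ring.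
    by rewrite ler_pM2r// ler_pM2r ?invr_gt0.
apply: filterS BC => w [n Hn].
have Nc := near_mul_ln_le (mulr_ge0 (powR_ge0 2 `|q^-1|) (powR_ge0 2 `|g|)) gg'.
have [n1 Hn1] := near_nat (filterI Nc (filterI (near_ln_ge 1) (near_ln_ge (ln 4)))).
exists (maxn (2 ^ n) (maxn n1 1)) => t; rewrite !geq_max => /and3P[nt n1t t1].
have [Nt [l1 l4]] := Hn1 t n1t.
have z1 := ln_ge1_gt1 l1.
pose k := trunc_log 2 t.
have /andP[kt tk] := trunc_log_bounds (isT : (1 < 2)%N) t1.
have nk : (n <= k.+1)%N.
  by apply: leqW; exact: trunc_log_max.
have Bk : below X (xl q^-1 g (2 ^ k.+1)%:R) (2 ^ k.+1) w.
  by apply: contrapT; exact: Hn.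
apply: le_trans (below_runmax (xl_ge0 _ _ _) Bk (ltnW tk)) _.
have t2 : (2 ^ k.+1)%:R <= 2 * t%:R :> R.
  by rewrite -natrM ler_nat expnS leq_mul2l.
have t3 : t%:R / 2 <= (2 ^ k.+1)%:R :> R.
  apply: (@le_trans _ _ t%:R); first by lra.
  by rewrite ler_nat ltnW.
have [h _] := xl_comparable q^-1 g l4 l1 t3 t2.
apply: (le_trans h); rewrite /xl mulrCA ler_wpM2l ?powR_ge0//.
Unshelve. all: by end_near. Qed.

Lemma as_lower (q b g : R) : 0 < q -> 0 <= b -> 1 + b < g * q ->
  (exists K x0, [/\ 0 < K, 1 < x0 & forall x t, x0 <= x -> (0 < t)%N ->
    fine (P (below X x t)) * t%:R <= K * xl q b (2 * x)]) ->
  forall g', g < g' ->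
  {ae P, forall w, exists t0 : nat, forall t, (t0 <= t)%N ->
     t%:R `^ q^-1 * ln t%:R `^ (- g') <= runmax X t w}.
Proof.
move=> q0 b0 gq [K [x0 [K0 x01 H]]] g' gg'.
have qi0 : 0 < q^-1 by rewrite invr_gt0.
pose E k := below X (xl q^-1 (- g) (2 ^ k)%:R) (2 ^ k).
have p20 k : (0 < 2 ^ k)%N by rewrite expn_gt0.
have BC : {ae P, forall w, exists n, forall k, (n <= k)%N -> ~ E k w}.
  apply: (@borel_cantelli_log R d T P E (K * 2 `^ q * (q^-1 + 2) `^ b) (g * q - b)).
  - by move=> k _; exact: (measurable_below filtF adX).
  - lra.
  - near=> z => k zE.
    have l1 : 1 <= ln z by near: z; exact: near_ln_ge.
    have l0 : 0 < ln z by lra.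
    have z1 := ln_ge1_gt1 l1; have z0 : 0 < z by lra.
    have hx : x0 <= xl q^-1 (- g) z by near: z; exact: near_xl_ge.
    have hl : ln (2 * xl q^-1 (- g) z) <= (q^-1 + 2) * ln z by near: z; exact: near_ln_xl_le.
    set x := xl q^-1 (- g) z in hx hl *.
    have x1 : 1 < x by lra.
    have := H x (2 ^ k)%N hx (p20 k).
    rewrite /E -zE -/x -ler_pdivlMr// => /le_trans; apply.
    rewrite ler_pdivrMr//.
    have -> : xl q b (2 * x) = 2 `^ q * (z * ln z `^ (- g * q)) * ln (2 * x) `^ b.
      rewrite /xl; congr (_ * _); rewrite powRM//; last lra.
      by rewrite xl_powR// mulVf ?gt_eqF// powRr1// ltW.
    have -> : - (g * q - b) = (- g * q) + b by ring.
    rewrite powRD_gt0// [leRHS](_ : _ = K * (2 `^ q * (z * ln z `^ (- g * q)) * ((q^-1 + 2) `^ b * ln z `^ b))); last by ring.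
    rewrite ler_pM2l// ler_wpM2l ?mulr_ge0 ?powR_ge0 ?(ltW z0)//.
    rewrite -powRM ?(ltW l0)//; last lra.
    by apply: ler_powRl => //; rewrite ln_ge0//; lra.
apply: filterS BC => w [n Hn].
have C0 : 0 <= 2 `^ `|q^-1| * 2 `^ `|- g| :> R by rewrite mulr_ge0 ?powR_ge0.
have Nc := near_mul_ln_le C0 gg'.
have [n1 Hn1] := near_nat (filterI Nc (near_ln_ge 1)).
have [n2 Hn2] := near_nat (filterI (near_ln_ge 1) (near_ln_ge (ln 4 : R))).
exists (maxn (2 ^ n) (maxn n1 (maxn 1 (2 ^ n2)))) => t; rewrite !geq_max => /and4P[nt n1t t1 n2t].
have [Nt l1] := Hn1 t n1t; have l0 : 0 < ln (t%:R : R) by lra.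
pose k := trunc_log 2 t.
have /andP[kt tk] := trunc_log_bounds (isT : (1 < 2)%N) t1.
have nk : (n <= k)%N by exact: trunc_log_max.
have n2k : (n2 <= 2 ^ k)%N.
  by apply: (@leq_trans k); [exact: trunc_log_max|rewrite ltnW// ltn_expl].
have [k1 k4] := Hn2 _ n2k.
apply: le_trans (not_below_runmax (Hn k nk) kt).
have t2 : (2 ^ k)%:R / 2 <= t%:R :> R.
  apply: (@le_trans _ _ (2 ^ k)%:R); last by rewrite ler_nat.
  by have := ler0n R (2 ^ k); lra.
have t3 : t%:R <= 2 * (2 ^ k)%:R :> R.
  by rewrite -natrM ler_nat -expnS ltnW.
have [h _] := xl_comparable q^-1 (- g) k4 k1 t2 t3.
have Cp : 0 < 2 `^ `|q^-1| * 2 `^ `|- g| :> R by rewrite mulr_gt0 ?powR_gt0.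
rewrite -(ler_pM2l Cp); apply: le_trans h.
rewrite /xl mulrCA ler_wpM2l ?powR_ge0// !powRN ler_pdivrMr ?powR_gt0//.
by rewrite [leRHS]mulrC ler_pdivlMr ?powR_gt0.
Unshelve. all: by end_near. Qed.

End almost_sure_bounds.

Lemma drift_coefE (R : realType) (s2 c q b l : R) : 0 < s2 ->
  drift_coef s2 c q b l = s2 / 2 * (q * (q - 1 + 2 * c / s2) * l + b * (2 * q - 1 + 2 * c / s2)).
Proof. by move=> s20; rewrite /drift_coef; field; rewrite gt_eqF. Qed.

Theorem theorem2p7 (R : realType) (d : measure_display) (T : measurableType d)
  (P : probability T R) (F : nat -> set (set T)) (X : nat -> T -> R)
  (S : set R) (c s2 : R) :
  A0 P F X S -> A1 P F X S -> A2 P F X c s2 -> A3 P X ->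
  let r := - (2 * c) / s2 in
  ((-1 < r <= 1) ->
   forall p : R, 2 < p -> Mp P F X p ->
   forall eps : R, 0 < eps ->
   {ae P, forall w, exists t0 : nat, forall t : nat, (t0 <= t)%N ->
      (t%:R `^ (2^-1)) * (ln t%:R `^ (- ((4 + r) / (1 + r)) - eps))
        <= runmax X t w
      /\ runmax X t w <= (t%:R `^ (2^-1)) * (ln t%:R `^ (3 / (1 + r) + eps))})
  /\
  (1 < r ->
   forall p : R, 1 + r < p -> Mp P F X p ->
   forall eps : R, 0 < eps ->
   {ae P, forall w, exists t0 : nat, forall t : nat, (t0 <= t)%N ->
      (t%:R `^ ((1 + r)^-1)) * (ln t%:R `^ (- (1 / (1 + r)) - eps))
        <= runmax X t w
      /\ runmax X t w <= (t%:R `^ ((1 + r)^-1)) * (ln t%:R `^ (2 / (1 + r) + eps))}).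
Proof.
move=> HA0 HA1 HA2 _ r.
have [_ [filtF adX _ _]] := HA0.
have s20 : 0 < s2 by case: HA2.
have dcE q b l : drift_coef s2 c q b l = s2 / 2 * (q * (q - 1 - r) * l + b * (2 * q - 1 - r)).
  by rewrite drift_coefE// /r mulNr !opprK.
have combine (f g : nat -> R) :
    {ae P, forall w, exists t0 : nat, forall t, (t0 <= t)%N -> f t <= runmax X t w} ->
    {ae P, forall w, exists t0 : nat, forall t, (t0 <= t)%N -> runmax X t w <= g t} ->
    {ae P, forall w, exists t0 : nat, forall t, (t0 <= t)%N ->
       f t <= runmax X t w /\ runmax X t w <= g t}.
  move=> H1 H2; apply: filterS2 H1 H2 => w [n Hn] [n' Hn'].
  exists (maxn n n') => t; rewrite geq_max => /andP[nt n't].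
  by split; [exact: Hn|exact: Hn'].
split.
- move=> /andP[r1 r2] p p2 [delta [C [d0 [Z HM]]]] eps e0.
  have r0 : 0 < 1 + r by lra.
  have h1 : 3 / 2 <= 3 / (1 + r) by rewrite ler_pM2l// lef_pV2 ?posrE//; lra.
  have e41 : (4 + r) / (1 + r) = 1 + 3 / (1 + r) by field; lra.
  apply: combine.
  + have -> : - ((4 + r) / (1 + r)) - eps = - ((4 + r) / (1 + r) + eps) by ring.
    apply: (@as_lower _ _ _ P F X filtF adX 2 1 2) => //; [lra| |rewrite e41; lra].
    apply: (@lower_tail _ _ _ P F X S c s2 p delta C Z 2 1 (s2 / 2) (s2 / 2)) => //; try lra.
    near=> z.
    have l1 : 1 <= ln z by near: z; exact: near_ln_ge.
    have z1 := ln_ge1_gt1 l1.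
    rewrite dcE /xl !subrr !powRr0 !mul1r.
    have hl : 0 <= (1 - r) * ln z by rewrite mulr_ge0//; lra.
    have : 0 <= s2 * ((1 - r) * ln z) by rewrite mulr_ge0// ltW.
    have : 0 <= s2 * (1 - r) by rewrite mulr_ge0 ?(ltW s20)//; lra.
    lra.
  + apply: (@as_upper _ _ _ P F X filtF adX 2 (5 / 4)) => //; [lra| |lra].
    apply: (@upper_tail _ _ _ P F X S c s2 p delta C Z 2 (-1) 1 (s2 * (1 - r) + 1)) => //; try lra.
    near=> z.
    have l1 : 1 <= ln z by near: z; exact: near_ln_ge.
    have l0 : 0 < ln z by lra.
    have z1 := ln_ge1_gt1 l1.
    rewrite dcE /xl subrr powRr0 mul1r.
    have -> : ln z `^ (-1 - 1) = (ln z)^-1 * (ln z)^-1.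
      by rewrite -[X in X * _]powR_inv1 ?(ltW l0)// -[X in _ * X]powR_inv1 ?(ltW l0)// -powRD_gt0.
    have il : (ln z)^-1 <= 1 by rewrite invf_le1.
    have il0 : 0 <= (ln z)^-1 by rewrite invr_ge0 ltW.
    have e1 : (ln z)^-1 * ln z = 1 by rewrite mulVf// gt_eqF.
    move: (ln z) ((ln z)^-1) il il0 e1 l1 => l i il il0 e1 l1.
    rewrite [leLHS](_ : _ = s2 * (1 - r) * (i * (i * l)) + i * i * (1 - s2 / 2 * (3 - r))); last by field.
    rewrite e1 mulr1; apply: lerD.
      by rewrite ler_piMr// mulr_ge0 ?(ltW s20)//; lra.
    have : 0 <= s2 / 2 * (3 - r) by rewrite mulr_ge0 ?divr_ge0 ?(ltW s20)//; lra.
    have : 0 <= i * i by rewrite mulr_ge0.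
    have : i * i <= 1 by rewrite mulr_ile1.
    move: (s2 / 2 * (3 - r)) (i * i) => u v; nra.
- move=> r1 p pr [delta [C [d0 [Z HM]]]] eps e0.
  have r0 : 0 < 1 + r by lra.
  have er : (1 + r) - 1 - r = 0 by ring.
  have er2 : 2 * (1 + r) - 1 - r = 1 + r by ring.
  have er3 : 1 / (1 + r) * (1 + r) = 1 by field; lra.
  have er4 : 2 / (1 + r) * (1 + r) = 2 by field; lra.
  have h0 : 0 < eps * (1 + r) by rewrite mulr_gt0.
  apply: combine.
  + have -> : - (1 / (1 + r)) - eps = - (1 / (1 + r) + eps) by ring.
    pose b := eps * (1 + r) / 4.
    have b0 : 0 < b by rewrite divr_gt0.
    apply: (@as_lower _ _ _ P F X filtF adX (1 + r) b (1 / (1 + r) + eps / 2)) => //; [exact: ltW| | |lra].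
      by rewrite mulrDl er3 /b; lra.
    apply: (@lower_tail _ _ _ P F X S c s2 p delta C Z (1 + r) b (s2 / 4 * (b * (1 + r))) (s2 / 4 * (b * (1 + r)))) => //; try lra.
    * by rewrite mulr_gt0 ?divr_gt0// mulr_gt0.
    * by rewrite mulr_gt0 ?divr_gt0// mulr_gt0.
    near=> z.
    have l1 : 1 <= ln z by near: z; exact: near_ln_ge.
    have l0 : 0 < ln z by lra.
    have z1 := ln_ge1_gt1 l1.
    have Y1 : 1 <= xl (1 + r - 2) (b - 1) z.
      by near: z; apply: near_xl_ge; lra.
    rewrite dcE er er2 mulr0 mul0r add0r.
    have : 0 < s2 / 4 * (b * (1 + r)) by rewrite mulr_gt0 ?divr_gt0// mulr_gt0.
    move=> k0; rewrite (_ : s2 / 2 * (b * (1 + r)) - _ = s2 / 4 * (b * (1 + r))); last by field.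
    by rewrite ler_peMl// ltW.
  + apply: (@as_upper _ _ _ P F X filtF adX (1 + r) (2 / (1 + r) + eps / 2)) => //; [| |lra].
      by rewrite mulrDl er4; lra.
    apply: (@upper_tail _ _ _ P F X S c s2 p delta C Z (1 + r) (-1) (s2 / 4 * (1 + r)) 0) => //; try lra.
      by rewrite mulr_gt0 ?divr_gt0.
    near=> z.
    have l1 : 1 <= ln z by near: z; exact: near_ln_ge.
    rewrite dcE er er2 mulr0 mul0r add0r mulr_ge0_le0 ?xl_ge0//.
    have : 0 < s2 * (1 + r) by rewrite mulr_gt0.
    lra.
Unshelve. all: by end_near. Qed.
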